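(* Let $(S,(x))$ be a regular local ring of dimension one. Let $R=S/(x^n)$ and $M_i=R/(x^i)$ for $1 \leq i \leq n$. Let $M$ be an $R$-module. Then $\operatorname{gldim} \operatorname{End}_R(M)$ is finite if and only if $\operatorname{add}(M)=\{M_1\}$, in which case the global dimension is $0$, or $\operatorname{add}(M)=\{M_1,\ldots,M_l\}$ for some $1\leq l \leq n$, in which case the global dimension is two. In particular, the global spectrum of $R$ is $\{0,2\}$.
   Context: For a finitely generated $R$-module $M$, $\operatorname{add} M$ is the subcategory of finitely generated $R$-modules consisting of direct summands of finite direct sums of copies of $M$; writing $\operatorname{add}(M)=\{M_1,\ldots,M_l\}$ means that $M_1,\ldots,M_l$ are, up to isomorphism, exactly the indecomposable modules in $\operatorname{add}(M)$. For a commutative Cohen--Macaulay ring $R$, the global spectrum $\operatorname{gs}(R)$ is the set of all finite values of $\operatorname{gldim} \operatorname{End}_R(M)$, where $M$ is a maximal Cohen--Macaulay $R$-module; maximal Cohen--Macaulay modules are not required to have full support.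
   Formalization: The claim that the global spectrum is {0,2} is made only for n ≥ 2 (for n = 1, R is a field and the spectrum is {0}); global dimension two is claimed for add(M)={M_1,…,M_l} only with 2 ≤ l ≤ n, since for l = 1 it is 0. *)

(* Defs.v *)
From HB Require Import structures.
From mathcomp Require Import all_boot all_algebra.
From mathcomp Require Import ring_quotient generic_quotient.
From mathcomp Require Import boolp classical_sets.

Set Implicit Arguments.
Unset Strict Implicit.
Unset Printing Implicit Defensive.

Import GRing.Theory.
Local Open Scope ring_scope.
Local Open Scope quotient_scope.

Section PrincipalQuotient.
Variables (S : comPzRingType) (a : S).

Definition principal : S -> bool := fun s => `[< exists b, s = b * a >].

Fact principal_zmod_closed : zmod_closed principal.
Proof.
split; first by apply/asboolP; exists 0; rewrite mul0r.
move=> u v /asboolP[b ->] /asboolP[c ->].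
by apply/asboolP; exists (b - c); rewrite mulrBl.
Qed.
HB.instance Definition _ := GRing.isZmodClosed.Build S principal
  principal_zmod_closed.

Fact principalMl s t : t \in principal -> s * t \in principal.
Proof.
by move=> /asboolP[b ->]; apply/asboolP; exists (s * b); rewrite mulrA.
Qed.

(* [{ideal_quot _}] only has a ring structure when the ideal is known to be
   proper; over [comPzRingType] no properness proof is needed.  The type
   [pquot] is both the ring S/(a) and the S-module S/(a). *)
Definition pquot : Type := Quotient.quot (GRing.ZmodClosed.clone S principal _).

HB.instance Definition _ := GRing.Zmodule.on pquot.
HB.instance Definition _ := ZmodQuotient.on pquot.

Definition pquot_one : pquot := \pi_pquot 1.
Definition pquot_mul (u v : pquot) : pquot := \pi_pquot (repr u * repr v).
Definition pquot_scale (s : S) (u : pquot) : pquot := \pi_pquot (s * repr u).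

Fact pquot_eq s t : (\pi_pquot s = \pi_pquot t) <-> s - t \in principal.
Proof.
rewrite /pquot; split=> [/eqP|h]; first by rewrite -Quotient.idealrBE.
by apply/eqP; rewrite -Quotient.idealrBE.
Qed.

Fact pquot_repr s : s - repr (\pi_pquot s) \in principal.
Proof. by apply/pquot_eq; rewrite reprK. Qed.

Fact pi_pquot_mul s t : \pi_pquot (s * t) = pquot_mul (\pi s) (\pi t).
Proof.
apply/pquot_eq; set s' := repr _; set t' := repr _.
have -> : s * t - s' * t' = t * (s - s') + s' * (t - t').
  by rewrite !mulrBr addrA (mulrC t s') (mulrC t s) subrK.
by apply: rpredD; apply: principalMl; apply: pquot_repr.
Qed.

Fact pi_pquot_scale s t : \pi_pquot (s * t) = pquot_scale s (\pi t).
Proof. by apply/pquot_eq; rewrite -mulrBr principalMl ?pquot_repr. Qed.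

Fact pi_pquotD s t : \pi_pquot (s + t) = \pi_pquot s + \pi_pquot t.
Proof. exact: (@Quotient.pi_add _ (GRing.ZmodClosed.clone S principal _)). Qed.

Fact pquot_ind (P : pquot -> Prop) :
  (forall s, P (\pi_pquot s)) -> forall u, P u.
Proof. by move=> h u; rewrite -[u]reprK. Qed.

Fact pquot_mulA : associative pquot_mul.
Proof.
elim/pquot_ind=> s; elim/pquot_ind=> t; elim/pquot_ind=> r.
by rewrite -(pi_pquot_mul t r) -(pi_pquot_mul s t) -!pi_pquot_mul mulrA.
Qed.

Fact pquot_mulC : commutative pquot_mul.
Proof.
elim/pquot_ind=> s; elim/pquot_ind=> t.
by rewrite -(pi_pquot_mul s t) -(pi_pquot_mul t s) mulrC.
Qed.

Fact pquot_mul1 : left_id pquot_one pquot_mul.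
Proof. by elim/pquot_ind=> s; rewrite -(pi_pquot_mul 1 s) mul1r. Qed.

Fact pquot_mulD : left_distributive pquot_mul +%R.
Proof.
elim/pquot_ind=> s; elim/pquot_ind=> t; elim/pquot_ind=> r.
by rewrite -pi_pquotD -(pi_pquot_mul s r) -(pi_pquot_mul t r)
  -(pi_pquot_mul (s + t)) mulrDl pi_pquotD.
Qed.

HB.instance Definition _ := GRing.Zmodule_isComPzRing.Build pquot
  pquot_mulA pquot_mulC pquot_mul1 pquot_mulD.

Fact pquot_scaleA s t u :
  pquot_scale s (pquot_scale t u) = pquot_scale (s * t) u.
Proof.
elim/pquot_ind: u => r.
by rewrite -(pi_pquot_scale t) -(pi_pquot_scale s) -(pi_pquot_scale (s * t))
  mulrA.
Qed.

Fact pquot_scale1 : left_id 1 pquot_scale.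
Proof. by elim/pquot_ind=> r; rewrite -(pi_pquot_scale 1 r) mul1r. Qed.

Fact pquot_scaleDr : right_distributive pquot_scale +%R.
Proof.
move=> s; elim/pquot_ind=> t; elim/pquot_ind=> r.
by rewrite -pi_pquotD -(pi_pquot_scale s t) -(pi_pquot_scale s r)
  -(pi_pquot_scale s) mulrDr pi_pquotD.
Qed.

Fact pquot_scaleDl u : {morph pquot_scale^~ u : s t / s + t}.
Proof.
move=> s t; elim/pquot_ind: u => r.
by rewrite -(pi_pquot_scale s r) -(pi_pquot_scale t r) -(pi_pquot_scale (s + t))
  mulrDl pi_pquotD.
Qed.

HB.instance Definition _ := GRing.Zmodule_isLmodule.Build S pquot
  pquot_scaleA pquot_scale1 pquot_scaleDr pquot_scaleDl.

End PrincipalQuotient.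

Section Endomorphisms.
Variables (R : pzRingType) (M : lmodType R).

Definition endo : Type := {linear M -> M}.

Definition endo_fun (f : endo) : M -> M := (f : {linear M -> M}).
Coercion endo_fun : endo >-> Funclass.

HB.instance Definition _ := gen_eqMixin endo.
HB.instance Definition _ := gen_choiceMixin endo.

Fact endoP (f g : endo) : endo_fun f =1 endo_fun g -> f = g.
Proof.
case: f g => [f cf] [g cg] /= /funext; rewrite /endo_fun /= => e.
by move: cf cg; rewrite e => cf cg; congr GRing.Linear.Pack; case: cf cg
  => [[h1] [h2]] [[h3] [h4]]; congr GRing.Linear.Class; congr (_ _);
  apply: Prop_irrelevance.
Qed.

Definition endo_zero : endo := (\0 : {linear M -> M}).
Definition endo_opp (f : endo) : endo := (\- f : {linear M -> M}).
Definition endo_add (f g : endo) : endo := (f \+ g : {linear M -> M}).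
Definition endo_one : endo := (idfun : {linear M -> M}).
Definition endo_mul (f g : endo) : endo := (f \o g : {linear M -> M}).

Fact endo_addA : associative endo_add.
Proof. by move=> f g h; apply: endoP => v; apply: addrA. Qed.
Fact endo_addC : commutative endo_add.
Proof. by move=> f g; apply: endoP => v; apply: addrC. Qed.
Fact endo_add0 : left_id endo_zero endo_add.
Proof. by move=> f; apply: endoP => v; apply: add0r. Qed.
Fact endo_addN : left_inverse endo_zero endo_opp endo_add.
Proof. by move=> f; apply: endoP => v; apply: addNr. Qed.
HB.instance Definition _ := GRing.isZmodule.Build endo
  endo_addA endo_addC endo_add0 endo_addN.

Fact endo_mulA : associative endo_mul.
Proof. by move=> f g h; apply: endoP. Qed.
Fact endo_mul1 : left_id endo_one endo_mul.
Proof. by move=> f; apply: endoP. Qed.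
Fact endo_1mul : right_id endo_one endo_mul.
Proof. by move=> f; apply: endoP. Qed.
Fact endo_mulDl : left_distributive endo_mul +%R.
Proof. by move=> f g h; apply: endoP. Qed.
Fact endo_mulDr : right_distributive endo_mul +%R.
Proof. by move=> f g h; apply: endoP => v; apply: (raddfD f). Qed.
HB.instance Definition _ := GRing.Zmodule_isPzRing.Build endo
  endo_mulA endo_mul1 endo_1mul endo_mulDl endo_mulDr.

End Endomorphisms.

Local Close Scope quotient_scope.
Local Open Scope classical_set_scope.

Section Rings.
Variable S : comPzRingType.

Definition is_ideal (I : set S) : Prop :=
  [/\ I 0, forall a b, I a -> I b -> I (a + b) & forall c a, I a -> I (c * a)].

Definition is_prime_ideal (P : set S) : Prop :=
  [/\ is_ideal P, ~ P 1 & forall a b, P (a * b) -> P a \/ P b].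

Definition is_maximal_ideal (m : set S) : Prop :=
  [/\ is_ideal m, ~ m 1
    & forall I, is_ideal I -> ~ I 1 -> m `<=` I -> I = m].

Definition is_local (m : set S) : Prop :=
  is_maximal_ideal m /\ forall m', is_maximal_ideal m' -> m' = m.

Definition ideal_generated_by (I : set S) (k : nat) (g : 'I_k -> S) : Prop :=
  I = [set a | exists c : 'I_k -> S, a = \sum_(i < k) c i * g i].

Definition noetherian : Prop :=
  forall I, is_ideal I -> exists k (g : 'I_k -> S), ideal_generated_by I g.

Definition prime_chain (d : nat) (p : nat -> set S) : Prop :=
  (forall i, (i <= d)%N -> is_prime_ideal (p i)) /\
  (forall i, (i < d)%N -> p i `<` p i.+1).

Definition krull_dim (d : nat) : Prop :=
  (exists p, prime_chain d p) /\
  (forall e p, prime_chain e p -> (e <= d)%N).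

Definition min_generators (I : set S) (d : nat) : Prop :=
  (exists g : 'I_d -> S, ideal_generated_by I g) /\
  (forall k (g : 'I_k -> S), ideal_generated_by I g -> (d <= k)%N).

Definition regular_local_ring (m : set S) (d : nat) : Prop :=
  [/\ noetherian, is_local m, krull_dim d & min_generators m d].

End Rings.

Section Modules.
Variable R : pzRingType.
Implicit Types M N : lmodType R.

Definition zero_module M : Prop := forall v : M, v = 0.

Definition fin_gen M : Prop :=
  exists k (g : 'I_k -> M),
    forall v, exists c : 'I_k -> R, v = \sum_(i < k) c i *: g i.

Definition mod_iso M N : Prop := exists f : {linear M -> N}, bijective f.

Definition indecomposable M : Prop :=
  ~ zero_module M /\
  forall A B : lmodType R,
    mod_iso M (A * B)%type -> zero_module A \/ zero_module B.

Definition in_add M N : Prop :=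
  fin_gen N /\
  exists k (L : lmodType R), mod_iso (N * L)%type {ffun 'I_k -> M}.

(* add(M) = {F 1, .., F l} *)
Definition add_eq M (F : nat -> lmodType R) (l : nat) : Prop :=
  forall N, (in_add M N /\ indecomposable N) <->
            (exists i, (1 <= i <= l)%N /\ mod_iso N (F i)).

End Modules.

Section GlobalDimension.
Variable A : pzRingType.

Definition projective (P : lmodType A) : Prop :=
  forall (U V : lmodType A) (g : {linear U -> V}) (f : {linear P -> V}),
    (forall v, exists u, g u = v) ->
    exists h : {linear P -> U}, forall p, g (h p) = f p.

(* There is a projective resolution
   0 -> P d -> .. -> P 1 -> P 0 -> N -> 0. *)
Definition proj_resolution (N : lmodType A) (d : nat) : Prop :=
  exists (P : nat -> lmodType A)
         (delta : forall i, {linear P i.+1 -> P i})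
         (eps : {linear P 0%N -> N}),
  [/\ forall i, projective (P i),
      forall v, exists p, eps p = v,
      forall p, eps p = 0 <-> exists q, delta 0%N q = p,
      forall i p, delta i p = 0 <-> exists q, delta i.+1 q = p
    & forall i, (d < i)%N -> zero_module (P i)].

(* The zero module has projective dimension -oo, hence no value in [nat]. *)
Definition proj_dim (N : lmodType A) (d : nat) : Prop :=
  [/\ ~ zero_module N, proj_resolution N d
    & forall e, proj_resolution N e -> (d <= e)%N].

(* The supremum of the projective dimensions of all left A-modules is d; as it
   is a natural number, it is attained.  The zero ring, all of whose modules
   are zero, has global dimension -oo and no value in [nat]. *)
Definition gldim (d : nat) : Prop :=
  (forall N, proj_resolution N d) /\ (exists N, proj_dim N d).

Definition finite_gldim : Prop := exists d, gldim d.

End GlobalDimension.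

Section GlobalSpectrum.
Variable R : comPzRingType.

Definition seq_submod (M : lmodType R) (s : seq R) : set M :=
  [set v | exists w : 'I_(size s) -> M, v = \sum_(i < size s) s`_i *: w i].

Definition regular_seq (M : lmodType R) (s : seq R) : Prop :=
  (forall i, (i < size s)%N -> forall v : M,
     seq_submod (take i s) (s`_i *: v) -> seq_submod (take i s) v) /\
  (exists v : M, ~ seq_submod s v).

Definition depth (I : set R) (M : lmodType R) (d : nat) : Prop :=
  (exists s : seq R,
     [/\ forall a, a \in s -> I a, regular_seq M s & size s = d]) /\
  (forall s : seq R,
     (forall a, a \in s -> I a) -> regular_seq M s -> (size s <= d)%N).

(* Only meant for local R.  The zero module has no regular sequence in the
   present sense (not even the empty one), hence no depth, and is excluded. *)
Definition max_cohen_macaulay (M : lmodType R) : Prop :=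
  fin_gen M /\
  exists (m : set R) (d : nat), [/\ is_local m, krull_dim R d & depth m M d].

Definition global_spectrum : set nat :=
  [set d | exists M : lmodType R, max_cohen_macaulay M /\ gldim (endo M) d].

End GlobalSpectrum.

(* Main.v *)
(* R is a chain ring: with y the class of x, every element is a unit or a
   multiple of y, y^n = 0 and y^(n-1) <> 0.  Hence a finitely generated M is a
   direct sum of cyclic modules R/(y^d), and add(M) is determined by the set D of
   the orders d that occur.  Let l = max D, A = End(M), and let e in A be the
   projection onto a summand of order l.

   Suppose D = {1, .., l}.  Free A-modules, and kernels of maps between them, are
   recovered from the R-module e N as N = Hom(M*, e N).  For such an N, a free
   cover P -> N is surjective on the elements killed by y^i for each i, and so it
   splits over R: a section is built by Zorn's lemma on pure submodules.  The
   splitting is then made A-linear, so N is projective.  Thus second syzygies are projective; if l = 1 every module is of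
   this form.  If l > 1, a resolution of length one of A/yA would make yA
   projective, so that the nilpotent element y would vanish in A.

   Otherwise D u {0} has consecutive elements p < j with j - p > 1.  For
   p < i < j, the A-modules T_i of elements of M killed by y^i are not projective,
   and T_(p+j-i) is a syzygy of T_i, so by Schanuel's lemma T_i has no finite
   projective resolution. *)

Require Import Defs.
From HB Require Import structures.
From mathcomp Require Import all_boot all_algebra.
From mathcomp Require Import ring_quotient generic_quotient finmap.
From mathcomp Require Import boolp classical_sets functions cardinality fsbigop.

Set Implicit Arguments.
Unset Strict Implicit.
Unset Printing Implicit Defensive.

Import GRing.Theory.
Local Open Scope ring_scope.
Local Open Scope quotient_scope.
Local Open Scope classical_set_scope.

(** * Short exact sequences and projective resolutions *)

Definition linear_of (R : pzRingType) (U V : lmodType R) (f : U -> V)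
    (hf : linear f) : {linear U -> V} :=
  HB.pack f (GRing.isLinear.Build R U V *:%R f hf).

Definition is_submod (R : pzRingType) (V : lmodType R) (P : set V) :=
  [/\ P 0, forall u v, P u -> P v -> P (u + v) & forall a v, P v -> P (a *: v)].

Section Submodule.
Variables (R : pzRingType) (V : lmodType R) (P : set V) (hP : is_submod P).

(** The proof is carried in the term so that instance inference can attach the closure property to
    the predicate. *)
Definition submod_pred (_ : is_submod P) : {pred V} := fun v => `[< P v >].

Fact submod_pred_closed : submod_closed (submod_pred hP).
Proof.
case: hP => P0 PD PZ; split; first exact/asboolP.
by move=> a u v /asboolP Pu /asboolP Pv; apply/asboolP; apply: PD => //; apply: PZ.
Qed.
HB.instance Definition _ := GRing.isSubmodClosed.Build R V (submod_pred hP)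
  submod_pred_closed.

Record submod : Type := Submod { submod_val : V; _ : submod_pred hP submod_val }.
HB.instance Definition _ := [isSub for submod_val].
HB.instance Definition _ := [Choice of submod by <:].
HB.instance Definition _ := [SubChoice_isSubLmodule of submod by <:].

Lemma submodP (u : submod) : P (val u).
Proof. by apply/asboolP; case: u. Qed.

Definition to_submod v (h : P v) : submod := Submod (asboolT h).

End Submodule.

Section ShortExact.
Variable R : pzRingType.
Implicit Types M N K P Q U : lmodType R.

Definition short_exact K P N (i : {linear K -> P}) (p : {linear P -> N}) :=
  [/\ injective i, forall v, exists u, p u = v
    & forall u, p u = 0 <-> exists k, i k = u].

Definition retract M N :=
  exists (i : {linear M -> N}) (r : {linear N -> M}), cancel i r.

Lemma projective_retract M N : retract M N -> projective N -> projective M.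
Proof.
move=> [i [r ri]] pN U V g f gs.
have [h hh] := pN U V g (f \o r : {linear N -> V}) gs.
by exists (h \o i : {linear M -> U}) => p /=; rewrite hh /= ri.
Qed.

Lemma linear_fst M N : linear (fst : (M * N)%type -> M). Proof. by []. Qed.

Lemma projective_prod M N :
  projective M -> projective N -> projective (M * N)%type.
Proof.
move=> pM pN U V g f gs.
have l1 : linear (fun m => f (m, 0)).
  by move=> a u v; rewrite -linearP; congr (f _); congr pair; rewrite /= scaler0 addr0.
have l2 : linear (fun m => f (0, m)).
  by move=> a u v; rewrite -linearP; congr (f _); congr pair; rewrite /= scaler0 addr0.
have [h1 e1] := pM U V g (linear_of l1) gs.
have [h2 e2] := pN U V g (linear_of l2) gs.
have l : linear (fun w : M * N => h1 w.1 + h2 w.2).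
  by move=> a u v /=; rewrite !linearP scalerDr addrACA.
exists (linear_of l) => -[m n] /=; rewrite linearD e1 e2 /= -linearD.
by congr (f _); congr pair; rewrite /= ?addr0 ?add0r.
Qed.

Lemma projective0 M : zero_module M -> projective M.
Proof.
move=> z U V g f gs.
have l : linear (fun _ : M => 0 : U) by move=> a u v; rewrite scaler0 addr0.
by exists (linear_of l) => p /=; rewrite linear0 (z p) linear0.
Qed.

(* Schanuel's lemma makes syzygies unique up to projective summands; the
   one-sided version below suffices and avoids constructing isomorphisms. *)
Definition stable_retract M N := exists2 P, projective P & retract M (N * P)%type.

Lemma stable_retract_refl M : stable_retract M M.
Proof.
have h0 : is_submod [set v : M | v = 0].
  by split=> //= [u v -> ->|a v ->]; rewrite ?addr0 ?scaler0.
exists (submod h0).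
  by apply: projective0 => v; apply: val_inj; rewrite (submodP v).
have l : linear (fun v : M => (v, 0 : submod h0)).
  by move=> a u v; congr pair; rewrite /= scaler0 addr0.
by exists (linear_of l), (linear_of (@linear_fst M (submod h0))).
Qed.

Lemma stable_retract_proj M N : stable_retract M N -> projective N -> projective M.
Proof.
by move=> [P pP /projective_retract rP] pN; apply: rP; apply: projective_prod.
Qed.

(** Universal property of the kernel; injectivity of [i] makes the pointwise choice linear. *)
Lemma short_exact_lift K P N U (i : {linear K -> P}) (p : {linear P -> N})
    (f : {linear U -> P}) :
  short_exact i p -> (forall u, p (f u) = 0) ->
  exists g : {linear U -> K}, forall u, i (g u) = f u.
Proof.
move=> [inj _ ex] h.
have [g hg] : exists g : U -> K, forall u, i (g u) = f u.
  by have /choice[g hg] := fun u => (ex (f u)).1 (h u); exists g.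
have l : linear g.
  by move=> a u v; apply: inj; rewrite linearP !hg linearP.
by exists (linear_of l).
Qed.

(** Projectivity lifts [s] and [r] to maps [S] from [Q'] to [Q * P] and [T] back. They need not
    compose to the identity, but the defect [q - T (S q)] takes values in [K']; adding it, on the
    summand [Q'], to the map induced by [T] gives a retraction of [K * Q'] onto [K']. *)
Lemma stable_retract_syzygy K Q N (K' Q' N' : lmodType R) (i : {linear K -> Q})
    (p : {linear Q -> N}) (i' : {linear K' -> Q'}) (p' : {linear Q' -> N'}) :
  projective Q -> projective Q' -> short_exact i p -> short_exact i' p' ->
  stable_retract N' N -> stable_retract K' K.
Proof.
move=> pQ pQ' e e' [P pP [s [r rs]]].
have [_ ps _] := e; have [_ p's p'k] := e'.
have lpP : linear (fun w : Q * P => (p w.1, w.2)).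
  by move=> a u v; congr pair; rewrite /= linearP.
have [S hS] : exists S : {linear Q' -> (Q * P)%type},
    forall q, (p (S q).1, (S q).2) = s (p' q).
  have [|S hS] := @pQ' _ _ (linear_of lpP) (s \o p' : {linear Q' -> _}).
    by move=> [n q]; have [u <-] := ps n; exists (u, q).
  by exists S.
have [T hT] : exists T : {linear (Q * P)%type -> Q'},
    forall w, p' (T w) = r (p w.1, w.2).
  have pQP : projective (Q * P)%type := projective_prod pQ pP.
  have [//|T hT] := pQP _ _ p' (r \o linear_of lpP : {linear (Q * P)%type -> N'}).
  by exists T.
have lh : linear (fun q => q - T (S q)).
  by move=> a u v; rewrite (linearP S) (linearP T) scalerBr opprD addrACA.
have [|h hh] := short_exact_lift (f := linear_of lh) e'.
  by move=> q /=; rewrite linearB hT hS rs subrr.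
have lS : linear (fun k => (S (i' k)).1) by move=> a u v; rewrite !linearP.
have pSk k : p (S (i' k)).1 = 0 /\ (S (i' k)).2 = 0.
  have := hS (i' k); have -> : p' (i' k) = 0 by apply/p'k; exists k.
  by rewrite linear0 => -[-> ->].
have [|a ha] := short_exact_lift (f := linear_of lS) e.
  by move=> k /=; case: (pSk k).
have lT : linear (fun k => T (i k, 0)).
  move=> c u v; rewrite -linearP; congr (T _); congr pair => /=.
    by rewrite linearP.
  by rewrite scaler0 addr0.
have [|b hb] := short_exact_lift (f := linear_of lT) e'.
  move=> k /=; rewrite hT /=.
  have -> : p (i k) = 0 by have [_ _ ->] := e; exists k.
  by rewrite -[RHS](linear0 r).
exists Q' => //.
have l1 : linear (fun k => (a k, i' k)).
  by move=> c u v; congr pair; rewrite /= linearP.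
have l2 : linear (fun w : K * Q' => b w.1 + h w.2).
  by move=> c u v /=; rewrite !linearP scalerDr addrACA.
exists (linear_of l1), (linear_of l2) => k /=.
have [inj' _ _] := e'; apply: inj'; rewrite linearD hb hh /= ha /=.
have -> : ((S (i' k)).1, 0) = S (i' k) by case: (S _) (pSk k) => u v /= [_ ->].
by rewrite addrC subrK.
Qed.

Lemma kernel_is_submod M N (p : {linear M -> N}) : is_submod [set v | p v = 0].
Proof.
split=> /= [|u v pu pv|a v pv]; first exact: linear0.
  by rewrite linearD pu pv addr0.
by rewrite linearZ /= pv scaler0.
Qed.

Definition submod_incl M (P : set M) (h : is_submod P) : {linear submod h -> M} :=
  (val : {linear submod h -> M}).

Lemma submod_incl_inj M (P : set M) (h : is_submod P) : injective (submod_incl h).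
Proof. by move=> u v; apply: val_inj. Qed.

Lemma kernel_short_exact P N (p : {linear P -> N}) :
  (forall v, exists u, p u = v) ->
  short_exact (submod_incl (kernel_is_submod p)) p.
Proof.
move=> ps; split=> [u v /val_inj//|//|u].
split=> [pu|[k <-]]; first by exists (to_submod (kernel_is_submod p) pu).
exact: (submodP k).
Qed.

Lemma proj_resolution_le N d e : (d <= e)%N ->
  proj_resolution N d -> proj_resolution N e.
Proof.
move=> de [P [D [p [h1 h2 h3 h4 h5]]]]; exists P, D, p; split=> // i /(leq_ltn_trans de).
exact: h5.
Qed.

Lemma proj_resolution0 N : projective N -> proj_resolution N 0.
Proof.
move=> pN.
have h0 : is_submod [set v : N | v = 0].
  by split=> //= [u v -> ->|a v ->]; rewrite ?addr0 ?scaler0.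
have z0 : zero_module (submod h0) by move=> v; apply: val_inj; rewrite (submodP v).
pose P i : lmodType R := if i is 0%N then N else submod h0.
have l0 (U V : lmodType R) : linear (fun _ : U => 0 : V).
  by move=> a u v; rewrite scaler0 addr0.
have lid (U : lmodType R) : linear (fun u : U => u) by [].
exists P, (fun i => linear_of (l0 (P i.+1) (P i))), (linear_of (lid N)); split.
- by case=> [|i] //=; apply: projective0.
- by move=> v; exists v.
- move=> v /=; split=> [->|[_ <-]//]; by exists 0.
- move=> i p; split=> // _; exists 0; exact/esym/(z0 p).
- by case.
Qed.

Lemma proj_resolutionS K P N (i : {linear K -> P}) (p : {linear P -> N}) d :
  projective P -> short_exact i p -> proj_resolution K d -> proj_resolution N d.+1.
Proof.
move=> pP [inj ps pk] [Q [D [q [h1 h2 h3 h4 h5]]]].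
pose P' j : lmodType R := if j is j'.+1 then Q j' else P.
pose D' j : {linear P' j.+1 -> P' j} :=
  match j with 0%N => (i \o q : {linear Q 0%N -> P}) | j'.+1 => D j' end.
exists P', D', p; split=> //.
- by case.
- move=> u; rewrite pk; split=> [[k <-]|[w <-]]; last by exists (q w).
  by have [w <-] := h2 k; exists w.
- case=> [|j] u; last exact: h4.
  by split=> [e|/h3 qu]; [apply/h3/inj; rewrite linear0; exact: e | rewrite /= qu linear0].
- by case=> // j; rewrite ltnS; apply: h5.
Qed.

(** The module [P 1] is zero, so the augmentation is bijective. *)
Lemma proj_resolution0_inv N : proj_resolution N 0 -> projective N.
Proof.
move=> [P [D [p [h1 h2 h3 _ h5]]]]; apply: projective_retract (h1 0%N).
have inj : injective p.
  move=> u v e; apply/eqP; rewrite -subr_eq0; apply/eqP.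
  have /h3[w <-] : p (u - v) = 0 by rewrite linearB e subrr.
  by rewrite (h5 1%N isT w) linear0.
have [f hf] := choice h2.
have l : linear f by move=> a u v; apply: inj; rewrite linearP !hf.
by exists (linear_of l), p.
Qed.

Lemma proj_resolutionS_inv N d : proj_resolution N d.+1 ->
  exists (P K : lmodType R) (i : {linear K -> P}) (p : {linear P -> N}),
    [/\ projective P, short_exact i p & proj_resolution K d].
Proof.
move=> [P [D [p [h1 h2 h3 h4 h5]]]].
exists (P 0%N), (submod (kernel_is_submod p)), (submod_incl (kernel_is_submod p)), p.
have e := kernel_short_exact h2; split=> //.
have [|q hq] := short_exact_lift (f := D 0%N) e.
  by move=> u; apply/h3; exists u.
exists (fun j => P j.+1), (fun j => D j.+1), q; split=> //.
- move=> v; have /h3[u uE] := submodP v; exists u.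
  by apply: val_inj; rewrite /= -uE -hq.
- move=> u; rewrite -h4 -hq; split=> [->|]; first by rewrite linear0.
  by rewrite -[X in _ = X](linear0 (submod_incl (kernel_is_submod p))) => /submod_incl_inj.
- by move=> j jd; apply: h5.
Qed.

(** Dimension shifting: each passage to a syzygy shortens the resolution by one, up to stable
    retracts. *)
Lemma proj_resolution_syzygy N d (K' Q' N' : lmodType R) (i' : {linear K' -> Q'})
    (p' : {linear Q' -> N'}) :
  proj_resolution N d.+1 -> stable_retract N' N -> projective Q' ->
  short_exact i' p' ->
  exists2 K, proj_resolution K d & stable_retract K' K.
Proof.
move=> /proj_resolutionS_inv[P [K [i [p [pP e rK]]]]] sr pQ' e'.
by exists K => //; apply: stable_retract_syzygy e e' sr.
Qed.

End ShortExact.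

(** * Quotient modules and free modules *)

Section QuotientModule.
Variables (R : pzRingType) (V : lmodType R) (P : set V) (hP : is_submod P).

Definition quotmod : Type :=
  Quotient.quot (GRing.ZmodClosed.clone V (submod_pred hP) _).
HB.instance Definition _ := GRing.Zmodule.on quotmod.
HB.instance Definition _ := ZmodQuotient.on quotmod.

Lemma quotmod_eq u v : \pi_quotmod u = \pi_quotmod v <-> P (u - v).
Proof.
rewrite /quotmod; split=> [/eqP|h].
  by rewrite -Quotient.idealrBE => /asboolP.
by apply/eqP; rewrite -Quotient.idealrBE; apply/asboolP.
Qed.

Lemma quotmodD u v : \pi_quotmod (u + v) = \pi_quotmod u + \pi_quotmod v.
Proof.
exact: (@Quotient.pi_add _ (GRing.ZmodClosed.clone V (submod_pred hP) _)).
Qed.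

Definition quotmod_scale (a : R) (u : quotmod) : quotmod :=
  \pi_quotmod (a *: repr u).

Lemma quotmod_scaleE a v : \pi_quotmod (a *: v) = quotmod_scale a (\pi v).
Proof.
apply/quotmod_eq; rewrite -scalerBr; have [_ _ PZ] := hP; apply: PZ.
by apply/quotmod_eq; rewrite reprK.
Qed.

Lemma quotmod_ind (Q : quotmod -> Prop) :
  (forall v, Q (\pi_quotmod v)) -> forall u, Q u.
Proof. by move=> h u; rewrite -[u]reprK. Qed.

Fact quotmod_scaleA a b u :
  quotmod_scale a (quotmod_scale b u) = quotmod_scale (a * b) u.
Proof.
elim/quotmod_ind: u => v.
by rewrite -(quotmod_scaleE b v) -(quotmod_scaleE a) -(quotmod_scaleE _ v) scalerA.
Qed.

Fact quotmod_scale1 : left_id 1 quotmod_scale.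
Proof. by move=> u; elim/quotmod_ind: u => v; rewrite -(quotmod_scaleE 1 v) scale1r. Qed.

Fact quotmod_scaleDr : right_distributive quotmod_scale +%R.
Proof.
move=> a u v; elim/quotmod_ind: u => u; elim/quotmod_ind: v => v.
by rewrite -quotmodD -(quotmod_scaleE a u) -(quotmod_scaleE a v)
  -(quotmod_scaleE a) scalerDr quotmodD.
Qed.

Fact quotmod_scaleDl u : {morph quotmod_scale^~ u : a b / a + b}.
Proof.
move=> a b; elim/quotmod_ind: u => v.
by rewrite -(quotmod_scaleE a v) -(quotmod_scaleE b v) -(quotmod_scaleE _ v)
  scalerDl quotmodD.
Qed.

HB.instance Definition _ := GRing.Zmodule_isLmodule.Build R quotmod
  quotmod_scaleA quotmod_scale1 quotmod_scaleDr quotmod_scaleDl.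

Fact quotmod_pi_linear : linear (fun v => \pi_quotmod v).
Proof. by move=> a u v; rewrite quotmodD quotmod_scaleE. Qed.
Definition quotmod_pi : {linear V -> quotmod} := linear_of quotmod_pi_linear.

Lemma quotmod_short_exact : short_exact (submod_incl hP) quotmod_pi.
Proof.
split=> [u v /val_inj //|u|u]; first by exists (repr u); apply: reprK.
have e0 v : quotmod_pi v = 0 <-> P v.
  by rewrite -(linear0 quotmod_pi) -{2}(subr0 v); apply: quotmod_eq.
split=> [/e0 Pu|[k <-]]; first by exists (to_submod hP Pu).
by apply/e0; exact: (submodP k).
Qed.

End QuotientModule.

Section FreeModule.
Variables (R : pzRingType) (I : choiceType).

Definition finitely_supported (f : I -> R^o) := finite_set [set i | f i != 0].

Fact finitely_supported_submod : is_submod (finitely_supported : set (I -> R^o)).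
Proof.
rewrite /finitely_supported; split=> /= [|f g hf hg|a f hf].
- by apply: (sub_finite_set _ (finite_set0 I)) => i /=; rewrite eqxx.
- have : finite_set ([set i | f i != 0] `|` [set i | g i != 0]).
    by rewrite finite_setU.
  apply: sub_finite_set => i /=.
  have [f0|] := eqVneq (f i) 0; last by left.
  have [g0|] := eqVneq (g i) 0; last by right.
  by rewrite fctE f0 g0 addr0 eqxx.
- apply: sub_finite_set hf => i /=; apply: contra => /eqP f0.
  by rewrite fctE f0 scaler0.
Qed.

(** The index type is arbitrary because the free covers below take all elements of a module as
    generators. *)
Definition freemod := submod finitely_supported_submod.

Lemma freemod_valZ a (f : freemod) i : val (a *: f) i = a *: (val f i : R^o).
Proof. by rewrite [val _]linearZ. Qed.

Lemma freemod_val0 i : val (0 : freemod) i = 0.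
Proof. by rewrite [val _]raddf0. Qed.

Fact delta_finsupp i : finitely_supported (fun j => if j == i then 1 else 0).
Proof.
apply: (sub_finite_set _ (finite_set1 i)) => j /=.
by have [//|_] := eqVneq j i; rewrite eqxx.
Qed.
Definition freemod_delta i : freemod := to_submod finitely_supported_submod (delta_finsupp i).

Definition freemod_ext (N : lmodType R) (w : I -> N) (f : freemod) : N :=
  \sum_(i \in [set: I]) (val f i : R) *: w i.

Fact freemod_ext_linear (N : lmodType R) (w : I -> N) : linear (freemod_ext w).
Proof.
move=> a f g; rewrite /freemod_ext.
(* A finite set containing both supports, over which all three sums can be compared. *)
pose S := [set i | val f i != 0] `|` [set i | val g i != 0].
have fS : finite_set S.
  by rewrite finite_setU; split; [exact: (submodP f)|exact: (submodP g)].
have E (h : freemod) : [set i | val h i != 0] `<=` S ->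
    \sum_(i \in [set: I]) (val h i : R) *: w i = \sum_(i <- fset_set S) (val h i : R) *: w i.
  move=> hS; rewrite -fsbig_finite //; apply/esym; apply: (fsbig_widen S setT) => // i [_ /= nS].
  have [->|/eqP h0] := eqVneq (val h i) 0; first by rewrite scale0r.
  by case: nS; apply: hS; apply/eqP.
rewrite !E; [|by right|by left|].
  rewrite scaler_sumr -big_split; apply: eq_bigr => i _ /=.
  by rewrite scalerA -scalerDl.
move=> i /=; have [f0|] := eqVneq (val f i) 0; last by left.
have [g0|] := eqVneq (val g i) 0; last by right.
by rewrite !fctE /= f0 g0 scaler0 addr0 eqxx.
Qed.
Definition freemod_lin (N : lmodType R) (w : I -> N) : {linear freemod -> N} :=
  linear_of (freemod_ext_linear w).

Lemma freemod_lin_delta (N : lmodType R) (w : I -> N) i :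
  freemod_lin w (freemod_delta i) = w i.
Proof.
rewrite /= /freemod_ext -(fsbig_widen [set i] setT) => [|//|j [_ /= ji]] /=.
  by rewrite fsbig_set1 eqxx scale1r.
by rewrite (negbTE (introN eqP ji)) scale0r.
Qed.

Lemma freemod_sum (f : freemod) :
  f = \sum_(i <- fset_set [set i | val f i != 0]) (val f i : R) *: freemod_delta i.
Proof.
apply: val_inj; rewrite raddf_sum; apply/funext => j.
have -> : (\sum_(i <- fset_set [set i | val f i != 0])
     val ((val f i : R) *: freemod_delta i)) j =
   \sum_(i <- fset_set [set i | val f i != 0]) (if j == i then val f j else 0).
  elim/big_rec2: _ => //= i s t _ <-; rewrite fctE; congr (_ + _).
  by rewrite /= fctE; case: eqP => [->|_]; rewrite ?scaler0 // /GRing.scale /= mulr1.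
have [f0|f0] := eqVneq (val f j) 0.
  by rewrite big1 // => i _; rewrite f0 if_same.
rewrite (bigD1_seq j) //=; last by rewrite in_fset_set ?inE //; exact: (submodP f).
by rewrite eqxx big1 ?addr0 // => i ij; rewrite eq_sym (negbTE ij).
Qed.

Lemma freemod_projective : projective freemod.
Proof.
move=> U V g f gs; have /choice[w hw] i := gs (f (freemod_delta i)).
have E (N : lmodType R) (h : {linear freemod -> N}) u : h u =
    \sum_(i <- fset_set [set i | val u i != 0]) (val u i : R) *: h (freemod_delta i).
  by rewrite {1}(freemod_sum u) linear_sum; apply: eq_bigr => i _; rewrite linearZ.
exists (freemod_lin w) => u.
rewrite (E _ f) -[g _]/((g \o freemod_lin w : {linear freemod -> V}) u) E.
apply: eq_bigr => i _; congr (_ *: _).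
by rewrite /= -[freemod_ext _ _]/(freemod_lin w _) freemod_lin_delta hw.
Qed.

End FreeModule.

(** * Modules over a chain ring *)

Section SubmodTheory.
Variables (R : pzRingType) (V : lmodType R) (P : set V) (hP : is_submod P).

Lemma is_submodB u v : P u -> P v -> P (u - v).
Proof. by case: hP => _ PD PZ Pu Pv; rewrite -scaleN1r; apply/PD/PZ. Qed.

Lemma is_submod_sum (I : Type) (s : seq I) (A : pred I) (F : I -> V) :
  (forall i, A i -> P (F i)) -> P (\sum_(i <- s | A i) F i).
Proof. by move=> h; case: hP => P0 PD _; elim/big_ind: _. Qed.

End SubmodTheory.

Section ChainRing.
Variable R : comPzRingType.

Definition divides (a r : R) := exists b, r = b * a.

Lemma divides_mull a b r : divides a r -> divides a (b * r).
Proof. by move=> [c ->]; exists (b * c); rewrite mulrA. Qed.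

Definition chain_ring (y : R) (n : nat) :=
  [/\ (0 < n)%N, y ^+ n = 0, y ^+ n.-1 <> 0
    & forall r, divides y r \/ exists u, u * r = 1].

Variables (y : R) (n : nat) (hR : chain_ring y n).

Lemma divides_pow_le a b : (a <= b)%N -> divides (y ^+ a) (y ^+ b).
Proof. by move=> ab; exists (y ^+ (b - a)); rewrite -exprD subnK. Qed.

Lemma divides_powW a b r : (a <= b)%N -> divides (y ^+ b) r -> divides (y ^+ a) r.
Proof. by move=> /divides_pow_le ab [c ->]; apply: divides_mull. Qed.

(** From [1 = b * y] follows [1 = b ^+ n * y ^+ n = 0], and then [y ^+ n.-1 = 0]. *)
Lemma not_divides1 : ~ divides y 1.
Proof.
case: hR => n0 yn yn1 _ [b b1]; apply: yn1.
by rewrite -[LHS]mul1r -[1](expr1n _ n) b1 exprMn yn mulr0 mul0r.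
Qed.

Lemma divides_or_sub_unit b : exists u, u * (1 - b * y) = 1.
Proof.
have [_ _ _ /(_ (1 - b * y))[[c e]|//]] := hR; case: not_divides1.
by exists (c + b); rewrite mulrDl -e subrK.
Qed.

(** By induction [r = r' * y ^+ e]. If [r'] were a unit with inverse [u], then [y ^+ (a + e)] would
    equal [u * b * y] times itself; as [1 - u * b * y] is a unit, [y ^+ (a + e)] would vanish
    although [a + e < n]. *)
Lemma divides_pow_cancel a e r : (a + e <= n)%N ->
  divides (y ^+ (a + e)) (y ^+ a * r) -> divides (y ^+ e) r.
Proof.
have [_ yn yn1 Hr] := hR.
elim: e => [|e IH] aen dv; first by exists r; rewrite expr0 mulr1.
have [||r' er] := IH; [by apply: leq_trans aen; rewrite addnS| |].
  by apply: divides_powW dv; rewrite addnS.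
have [[b eb]|[u eu]] := Hr r'; first by exists b; rewrite er eb exprS mulrA.
have [b eb] := dv; have [w ew] := divides_or_sub_unit (u * b).
case: yn1; suff h : y ^+ (a + e) = 0.
  have ae : (a + e <= n.-1)%N by rewrite -ltnS prednK ?(leq_trans _ aen) // addnS.
  by rewrite -(subnK ae) exprD h mulr0.
rewrite -[LHS]mul1r -ew -(mulrA w) mulrBl mul1r.
have -> : u * b * y * y ^+ (a + e) = u * (b * y ^+ (a + e.+1)).
  by rewrite addnS exprS !mulrA.
rewrite -eb er; have -> : u * (y ^+ a * (r' * y ^+ e)) = u * r' * y ^+ (a + e).
  by rewrite exprD !mulrA; congr (_ * _); rewrite -!mulrA; congr (_ * _); rewrite mulrC.
by rewrite eu mul1r subrr mulr0.
Qed.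

Lemma divides_pow_leq a b : (b <= n)%N -> divides (y ^+ b) (y ^+ a) -> (b <= a)%N.
Proof.
move=> bn dv; rewrite leqNgt; apply/negP => ab; apply: not_divides1.
rewrite -[y]expr1; apply: (divides_powW (b := (b - a)%N)); first by rewrite subn_gt0.
by apply: (@divides_pow_cancel a); rewrite ?mulr1 subnKC // ltnW.
Qed.

(** The quotient M/Y is the direct sum of the cyclic modules R/(y^(d t)) on the classes of the
    [g t]. Working relative to [Y] lets an induction enlarge [Y] without forming quotients. *)
Definition cyclic_basis_mod (M : lmodType R) (Y : set M) r (g : nat -> M)
    (d : nat -> nat) :=
  [/\ forall v, exists c, Y (v - \sum_(t < r) c (t : nat) *: g t),
      forall t, (t < r)%N -> (0 < d t <= n)%N /\ Y (y ^+ d t *: g t)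
    & forall c, Y (\sum_(t < r) c (t : nat) *: g t) ->
        forall t, (t < r)%N -> divides (y ^+ d t) (c t)].

(** If [s = b * y ^+ e] with [b] a unit and [e <= m], then [y ^+ e *: z], and with it [y ^+ m *: z],
    would lie in [Y]. *)
Lemma divides_annihilator (M : lmodType R) (Y : set M) (z : M) m s :
  is_submod Y -> ~ Y (y ^+ m *: z) -> Y (s *: z) -> divides (y ^+ m.+1) s.
Proof.
move=> [_ _ YZ] nz Ys; have [_ _ _ Hr] := hR.
suff h e : (e <= m.+1)%N -> divides (y ^+ e) s by apply: h.
elim: e => [|e IH] em; first by exists s; rewrite mulr1.
have [b eb] := IH (ltnW em).
have [[c ec]|[u eu]] := Hr b; first by exists c; rewrite eb ec exprS mulrA.
case: nz; rewrite -(subnK (n := m) em) exprD -scalerA; apply: (YZ).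
have -> : y ^+ e = u * s by rewrite eb mulrA eu mul1r.
by rewrite -scalerA; apply: YZ.
Qed.

(* A generator of maximal order modulo [Y] spans a pure submodule modulo [Y], so
   that a basis modulo it can be corrected to elements of the same orders. *)
Lemma exists_cyclic_basis_mod (M : lmodType R) k : forall (h : nat -> M) (Y : set M),
  is_submod Y -> (forall v, exists c, Y (v - \sum_(t < k) c (t : nat) *: h t)) ->
  exists r g d, cyclic_basis_mod Y r g d.
Proof.
elim: k => [|k IH] h Y hY span.
  exists 0%N, h, (fun _ => 0%N); split=> [v|t|c _ t]; rewrite ?ltn0 //.
have [Y0 YD YZ] := hY; have [_ yn _ _] := hR.
(* The least such [m] is the maximal order of a generator modulo [Y]; by spanning, [y ^+ m] then
   kills all of M/Y. *)
pose killed m := `[< forall t, (t < k.+1)%N -> Y (y ^+ m *: h t) >].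
have exm : exists m, killed m.
  by exists n; apply/asboolP => t _; rewrite yn scale0r.
case: (ex_minnP exm) => m /asboolP Ym minm.
have mn : (m <= n)%N by apply: minm; apply/asboolP => t _; rewrite yn scale0r.
have {}Ym v : Y (y ^+ m *: v).
  have [c Yc] := span v; rewrite -[v](subrK (\sum_(t < k.+1) c t *: h t)) scalerDr.
  apply: YD; first exact: YZ.
  rewrite scaler_sumr; apply: is_submod_sum => // t _.
  by rewrite scalerA mulrC -scalerA; apply/YZ/Ym.
case: m => [|m] in minm mn Ym *.
  exists 0%N, h, (fun _ => 0%N); split=> [v|t|c _ t]; rewrite ?ltn0 //; exists (fun _ => 0).
  by rewrite big_ord0 subr0 -[v]scale1r -(expr0 y).
have [j [jk nYj]] : exists j, (j < k.+1)%N /\ ~ Y (y ^+ m *: h j).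
  apply: contrapT => H; suff : (m.+1 <= m)%N by rewrite ltnn.
  apply: minm; apply/asboolP => t tk; apply: contrapT => nY; apply: H.
  by exists t.
set z := h j in nYj.
pose Y' := [set v | exists a, Y (v - a *: z)].
have hY' : is_submod Y'.
  split=> [|u v [a ha] [b hb]|b v [a ha]].
  - by exists 0; rewrite scale0r subr0.
  - by exists (a + b); rewrite scalerDl opprD addrACA; apply: YD.
  - by exists (b * a); rewrite -scalerA -scalerBr; apply: YZ.
have sub v : Y v -> Y' v by exists 0; rewrite scale0r subr0.
(* Modulo [z = h j] the other generators suffice; the last one moves into place [j], which leaves
   [k] of them. *)
pose h' t := if t == j then h k else h t.
have [v|r [g [d [bs bo bi]]]] := IH h' Y' hY'.
  have [c Yc] := span v.
  exists (fun t => if t == j then c k else c t), (c j).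
  apply: (eq_ind _ Y Yc); rewrite -addrA -opprD; congr (_ - _).
  rewrite big_ord_recr /=; case: (ltnP j k) => [jk'|kj].
    rewrite (bigD1 (Ordinal jk')) // [in RHS](bigD1 (Ordinal jk')) //= /h' eqxx.
    have -> : \sum_(i < k | i != Ordinal jk')
        (if i == j :> nat then c k else c i) *: (if i == j :> nat then h k else h i)
        = \sum_(i < k | i != Ordinal jk') c i *: h i.
      apply: eq_bigr => i; rewrite -val_eqE /= => /negbTE ->; by [].
    by rewrite addrAC [RHS]addrAC; congr (_ + _); rewrite addrC.
  have ejk : j = k by apply/eqP; rewrite eqn_leq kj -ltnS jk.
  rewrite /z ejk; congr (_ + _); apply: eq_bigr => i _.
  by rewrite /h' ejk (ltn_eqF (ltn_ord i)).
have dm t : (t < r)%N -> (d t <= m.+1)%N.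
  move=> tr; have [/andP[_ dn] _] := bo t tr; apply: divides_pow_leq => //.
  move: (bi (fun s => if s == t then y ^+ m.+1 else 0)) => /= /(_ _ t tr).
  rewrite eqxx; apply.
  rewrite (bigD1 (Ordinal tr)) //= eqxx big1 ?addr0; first exact/sub/Ym.
  by move=> s; rewrite -val_eqE /= => /negbTE ->; rewrite scale0r.
(* Modulo [Y], [y ^+ d t *: g t] is some [a *: z]. Since [z] has the maximal order, [y ^+ d t]
   divides [a], and subtracting a multiple of [z] from [g t] restores the order [d t]. *)
have /choice[c' hc'] t : exists c', (t < r)%N -> Y (y ^+ d t *: (g t - c' *: z)).
  case tr: (t < r)%N; last by exists 0.
  have [_ [a Ya]] := bo t tr.
  have [||b eb] := @divides_pow_cancel (m.+1 - d t) (d t) a.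
  - by rewrite subnK ?(dm _ tr).
  - rewrite subnK; last exact: dm.
    apply: divides_annihilator nYj _ => //.
    have -> : (y ^+ (m.+1 - d t) * a) *: z = y ^+ m.+1 *: g t -
        y ^+ (m.+1 - d t) *: (y ^+ d t *: g t - a *: z).
      by rewrite scalerBr !scalerA -exprD subnK ?(dm _ tr) // opprB addrC subrK.
    by apply: is_submodB => //; apply: YZ.
  by exists b => _; rewrite scalerBr scalerA mulrC -eb.
pose G t := if t is t'.+1 then g t' - c' t' *: z else z.
pose D t := if t is t'.+1 then d t' else m.+1.
exists r.+1, G, D; split.
- move=> v; have [c [a Ya]] := bs v.
  exists (fun t => if t is t'.+1 then c t' else a + \sum_(t < r) c t * c' t).
  rewrite big_ord_recl; apply: (eq_ind _ Y Ya); rewrite -addrA; congr (_ + _).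
  under [X in - (_ + X)]eq_bigr => i _ do rewrite lift0 /= scalerBr scalerA.
  rewrite sumrB -scaler_suml scalerDl -opprD /=; congr (- _).
  by rewrite addrACA subrr addr0 addrC.
- case=> [|t] /= tr; first by split; [rewrite mn | exact: Ym].
  by have [? _] := bo t tr; split=> //; apply: hc'.
- move=> c; rewrite big_ord_recl; under eq_bigr => i _ do rewrite lift0 /=.
  rewrite /= => Yc.
  have H t : (t < r)%N -> divides (y ^+ d t) (c t.+1).
    apply: (bi (fun t => c t.+1)); exists (\sum_(t < r) c t.+1 * c' t - c 0%N).
    apply: (eq_ind _ Y Yc); under [X in _ + X = _]eq_bigr => i _ do rewrite scalerBr scalerA.
    by rewrite sumrB -scaler_suml scalerBl opprB addrCA.
  case=> [_|t] /=; last exact: H.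
  apply: divides_annihilator nYj _ => //.
  rewrite -[c 0%N *: z](addrK (\sum_(t < r) c t.+1 *: (g t - c' t *: z))).
  apply: is_submodB => //; apply: is_submod_sum => // t _.
  have [b ->] := H t (ltn_ord t); rewrite -scalerA; exact/YZ/hc'.
Qed.
End ChainRing.

(** * Isomorphisms, retracts and membership in add(M) *)

Section Isomorphisms.
Variable R : pzRingType.
Implicit Types M N K L : lmodType R.

Lemma mod_iso_refl M : mod_iso M M.
Proof. by exists (idfun : {linear M -> M}), idfun. Qed.

Lemma mod_iso_sym M N : mod_iso M N -> mod_iso N M.
Proof.
move=> [f [g fg gf]]; have l : linear g.
  by move=> a u v; apply: (can_inj fg); rewrite gf linearP !gf.
by exists (linear_of l), f.
Qed.

Lemma mod_iso_trans M N K : mod_iso M N -> mod_iso N K -> mod_iso M K.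
Proof.
by move=> [f bf] [g bg]; exists (g \o f : {linear M -> K}); apply: bij_comp.
Qed.

Lemma retract_iso M N : mod_iso M N -> retract M N.
Proof.
move=> [f [g fg gf]]; have l : linear g.
  by move=> a u v; apply: (can_inj fg); rewrite gf linearP !gf.
by exists f, (linear_of l).
Qed.

Lemma retract_trans M N K : retract M N -> retract N K -> retract M K.
Proof.
move=> [i [r ri]] [i' [r' ri']].
exists (i' \o i : {linear M -> K}), (r \o r' : {linear K -> M}).
by move=> u; rewrite /= ri' ri.
Qed.

Lemma retract_fst M N : retract M (M * N)%type.
Proof.
have l : linear (fun v : M => (v, 0 : N)).
  by move=> a u v; congr pair; rewrite /= scaler0 addr0.
by exists (linear_of l), (linear_of (@linear_fst R M N)).
Qed.

Lemma retract_complement M N : retract N M -> exists L, mod_iso (N * L)%type M.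
Proof.
move=> [i [r ri]]; pose L := submod (kernel_is_submod r); exists L.
have l : linear (fun w : N * L => i w.1 + val w.2).
  by move=> a u v /=; rewrite !linearP scalerDr addrACA.
have k m : r (m - i (r m)) = 0 by rewrite linearB ri subrr.
exists (linear_of l), (fun m => (r m, to_submod (kernel_is_submod r) (k m))).
- move=> [u v]; have rv := submodP v.
  have e : r (i u + val v) = u by rewrite linearD ri rv addr0.
  by congr pair => //; apply: val_inj; rewrite /= e addrC addKr.
- by move=> m; rewrite /= addrC subrK.
Qed.

(** Trades the unspecified complement for a retraction, since retractions compose. *)
Lemma in_add_retractP M N :
  in_add M N <-> fin_gen N /\ exists k, retract N {ffun 'I_k -> M}.
Proof.
split=> -[fg [k h]]; split=> //; exists k.
  by case: h => L /retract_iso; apply: retract_trans; apply: retract_fst.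
exact: retract_complement.
Qed.

Lemma retract_ffun1 M : retract M {ffun 'I_1 -> M}.
Proof.
have l1 : linear (fun v : M => [ffun => v] : {ffun 'I_1 -> M}).
  by move=> a u v; apply/ffunP => s; rewrite !ffunE.
have l2 : linear (fun w : {ffun 'I_1 -> M} => w ord0).
  by move=> a u v; rewrite !ffunE.
by exists (linear_of l1), (linear_of l2) => v; rewrite /= ffunE.
Qed.

Lemma indecomposable_iso M N : mod_iso M N -> indecomposable N -> indecomposable M.
Proof.
move=> iMN [nz h]; split=> [z|A B iMAB].
  by apply: nz => v; have [f [g fg gf]] := iMN; rewrite -(gf v) (z (g v)) linear0.
by apply: h; apply: mod_iso_trans iMAB; apply: mod_iso_sym.
Qed.

Lemma fin_gen_iso M N : mod_iso M N -> fin_gen N -> fin_gen M.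
Proof.
move=> /mod_iso_sym[f [f' ff' f'f]] [k [g h]]; exists k, (f \o g) => v.
have [c e] := h (f' v); exists c; rewrite -(f'f v) e linear_sum.
by apply: eq_bigr => i _; rewrite linearZ.
Qed.

End Isomorphisms.

(** * The cyclic modules R/(a) *)

Section CyclicModules.
Variables (R : comPzRingType) (a : R).

Lemma pquot_eq0 s : \pi_(pquot a) s = 0 <-> divides a s.
Proof.
have <- : \pi_(pquot a) 0 = 0.
  by apply: (addrI (\pi_(pquot a) 0)); rewrite addr0 -pi_pquotD addr0.
by split=> [/pquot_eq|h]; [rewrite subr0 => /asboolP|apply/pquot_eq/asboolP; rewrite subr0].
Qed.

Lemma pquot_scaleE s t : s *: \pi_(pquot a) t = \pi_(pquot a) (s * t).
Proof. by rewrite pi_pquot_scale. Qed.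

Lemma pquot_mulE s t :
  (\pi_(pquot a) s : pquot a) * (\pi_(pquot a) t : pquot a) = \pi_(pquot a) (s * t).
Proof. by rewrite pi_pquot_mul. Qed.

Lemma pquot_genE (u : pquot a) : u = repr u *: \pi_(pquot a) 1.
Proof. by rewrite pquot_scaleE mulr1 reprK. Qed.

Lemma fin_gen_pquot : fin_gen (pquot a : lmodType R).
Proof.
exists 1%N, (fun _ => \pi_(pquot a) 1) => v; exists (fun _ => repr v).
by rewrite big_ord_recl big_ord0 addr0 -pquot_genE.
Qed.

Lemma pquot_lift (M : lmodType R) (v : M) : a *: v = 0 ->
  exists f : {linear (pquot a : lmodType R) -> M}, forall s, f (\pi_(pquot a) s) = s *: v.
Proof.
move=> av; pose f (u : pquot a) := repr u *: v.
have fE s : f (\pi_(pquot a) s) = s *: v.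
  have /asboolP[b e] := pquot_repr a s; apply/esym/eqP; rewrite -subr_eq0 -scalerBl.
  by rewrite e -scalerA av scaler0.
have l : linear f.
  move=> b; elim/pquot_ind => s; elim/pquot_ind => t.
  by rewrite pquot_scaleE -pi_pquotD !fE scalerDl scalerA.
by exists (linear_of l).
Qed.

End CyclicModules.

(** * Cyclic decompositions and the orders they determine *)

Section Bases.
Variables (R : comPzRingType) (y : R) (n : nat) (hR : chain_ring y n).
Implicit Types M N : lmodType R.

Definition cyclic_basis M r (g : nat -> M) (d : nat -> nat) :=
  [/\ forall v, exists c, v = \sum_(t < r) c (t : nat) *: g t,
      forall t, (t < r)%N -> (0 < d t <= n)%N /\ y ^+ d t *: g t = 0
    & forall c, \sum_(t < r) c (t : nat) *: g t = 0 ->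
        forall t, (t < r)%N -> divides (y ^+ d t) (c t)].

Lemma exists_cyclic_basis M : fin_gen M -> exists r g d, @cyclic_basis M r g d.
Proof.
move=> [k [g h]].
(* Functions on ['I_k] are extended to [nat] by a default value, as bases are indexed by [nat]. *)
pose ext T (x0 : T) (f : 'I_k -> T) t := oapp f x0 (insub t).
have extE T (x0 : T) f (t : 'I_k) : ext T x0 f t = f t by rewrite /ext valK.
have hY : is_submod [set v : M | v = 0].
  by split=> //= [u v -> ->|b v ->]; rewrite ?addr0 ?scaler0.
have [v|r [g' [d [h1 h2 h3]]]] := exists_cyclic_basis_mod hR (k := k) (h := ext _ 0 g) hY.
  have [c e] := h v; exists (ext _ 0 c); apply/eqP; rewrite /= subr_eq0 {1}e; apply/eqP.
  by apply: eq_bigr => t _; rewrite !extE.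
exists r, g', d; split=> // v; have [c /= /eqP] := h1 v.
by rewrite subr_eq0 => /eqP; exists c.
Qed.

(** Coordinates are chosen, not unique; two choices differ at [t] by a multiple of [y ^+ d t], which
    kills [u t], so the resulting value is well defined and linear. *)
Lemma cyclic_basis_lin M N r g d (u : nat -> N) : @cyclic_basis M r g d ->
  (forall t, (t < r)%N -> y ^+ d t *: u t = 0) ->
  exists f : {linear M -> N}, forall t, (t < r)%N -> f (g t) = u t.
Proof.
move=> [/choice[c hc] _ h3] hu; pose f v := \sum_(t < r) c v t *: u t.
have fE b : f (\sum_(t < r) b (t : nat) *: g t) = \sum_(t < r) b (t : nat) *: u t.
  apply/eqP; rewrite -subr_eq0 -sumrB; apply/eqP/big1 => t _.
  set v := \sum_(t < r) _; rewrite -scalerBl.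
  have [||q ->] := h3 (fun t => c v t - b t) _ t; last 2 first.
  - exact: ltn_ord.
  - by rewrite -scalerA hu ?scaler0.
  under eq_bigr => i _ do rewrite scalerBl.
  by rewrite sumrB -hc subrr.
have l : linear f.
  move=> b v w.
  have -> : b *: v + w = \sum_(t < r) (b * c v t + c w t) *: g t.
    rewrite {1}(hc v) {1}(hc w) scaler_sumr -big_split; apply: eq_bigr => t _ /=.
    by rewrite scalerDl scalerA.
  rewrite (fE (fun t => b * c v t + c w t)) /f scaler_sumr -big_split.
  by apply: eq_bigr => t _ /=; rewrite scalerDl scalerA.
exists (linear_of l) => t tr /=.
have -> : g t = \sum_(s < r) (s == t :> nat)%:R *: g s.
  rewrite (bigD1 (Ordinal tr)) //= eqxx scale1r big1 ?addr0 // => s.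
  by rewrite -val_eqE /= => /negbTE ->; rewrite scale0r.
rewrite (fE (fun s => (s == t :> nat)%:R)).
rewrite (bigD1 (Ordinal tr)) //= eqxx scale1r big1 ?addr0 // => s.
by rewrite -val_eqE /= => /negbTE ->; rewrite scale0r.
Qed.

Lemma cyclic_basis_eq0 M r g d t c : @cyclic_basis M r g d -> (t < r)%N ->
  c *: g t = 0 <-> divides (y ^+ d t) c.
Proof.
move=> [_ h2 h3] tr; split=> [e|[b ->]]; last first.
  by rewrite -scalerA; have [_ ->] := h2 t tr; rewrite scaler0.
move: (h3 (fun s => if s == t then c else 0)) => /= /(_ _ t tr).
rewrite eqxx; apply; rewrite (bigD1 (Ordinal tr)) //= eqxx e big1 ?addr0 // => s.
by rewrite -val_eqE /= => /negbTE ->; rewrite scale0r.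
Qed.

Lemma cyclic_basis_retract M r g d t : @cyclic_basis M r g d -> (t < r)%N ->
  retract (pquot (y ^+ d t) : lmodType R) M.
Proof.
move=> bM tr; have [_ h2 _] := bM.
have [_ /pquot_lift[f fE]] := h2 t tr.
have [|p pE] := @cyclic_basis_lin M (pquot (y ^+ d t) : lmodType R) r g d
    (fun s => if s == t then \pi_(pquot (y ^+ d t)) 1 else 0) bM.
  move=> s sr; case: eqP => [->|_]; last by rewrite scaler0.
  by rewrite pquot_scaleE; apply/pquot_eq0; exists 1; rewrite mulrC.
exists f, p => u; rewrite [u in LHS]pquot_genE linearZ linearZ /= fE linearZ /= pE //.
by rewrite eqxx scale1r -pquot_genE.
Qed.

Lemma divides_unit_cancel a c u : ~ divides y u -> divides a (c * u) -> divides a c.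
Proof.
have [_ _ _ /(_ u)[//|[w e]]] := hR => _ [b eb]; exists (w * b).
by rewrite -mulrA -eb mulrCA e mulr1.
Qed.

(** The image [w] of 1 generates the product, so [(w.1, 0) = s *: w] for some [s]. Then [1 - s]
    kills [w.1] and [s] kills [w.2], and one of these two scalars is a unit. *)
Lemma pquot_indecomposable i : (0 < i <= n)%N ->
  indecomposable (pquot (y ^+ i) : lmodType R).
Proof.
move=> /andP[i0 iN].
have nz : \pi_(pquot (y ^+ i)) 1 <> 0.
  move=> /pquot_eq0 dv; apply: (not_divides1 hR); rewrite -[y]expr1.
  exact: divides_powW dv.
split=> [z|A B [f [f' ff' f'f]]]; first exact: nz.
pose w := f (\pi_(pquot (y ^+ i)) 1).
have gen z : exists s, z = s *: w.
  by exists (repr (f' z)); rewrite /w -linearZ /= -pquot_genE f'f.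
have [s es] := gen (w.1, 0); have [e1 e2] : w.1 = s *: w.1 /\ 0 = s *: w.2.
  by split; [exact: (congr1 fst es) | exact: (congr1 snd es)].
have [_ _ _ /(_ s)[[b eb]|[u eu]]] := hR.
- left => v; have [t et] := gen (v, 0); rewrite -[v]/((v, 0 : B).1) et /=.
  have [u eu] := divides_or_sub_unit hR b; suff -> : w.1 = 0 by rewrite scaler0.
  by rewrite -[LHS]scale1r -eu -scalerA -eb scalerBl scale1r -e1 subrr scaler0.
- right => v; have [t et] := gen (0, v); rewrite -[v]/((0 : A, v).2) et /=.
  suff -> : w.2 = 0 by rewrite scaler0.
  by rewrite -[LHS]scale1r -eu -scalerA -e2 scaler0.
Qed.

(** Annihilators are compared: [y ^+ j] kills the second module, hence the first, so [i <= j], and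
    symmetrically. *)
Lemma pquot_pow_iso i j : (0 < i <= n)%N -> (0 < j <= n)%N ->
  mod_iso (pquot (y ^+ i) : lmodType R) (pquot (y ^+ j) : lmodType R) -> i = j.
Proof.
suff h i' j' : (0 < i' <= n)%N ->
    mod_iso (pquot (y ^+ i') : lmodType R) (pquot (y ^+ j') : lmodType R) ->
    (i' <= j')%N.
  move=> hi hj iso; apply/eqP; rewrite eqn_leq (h i j) //= (h j i) //.
  exact: mod_iso_sym.
move=> /andP[i0 iN] [f [f' ff' _]]; apply: (divides_pow_leq hR) => //.
rewrite -[y ^+ j']mulr1; apply/pquot_eq0; rewrite -pquot_scaleE.
apply: (can_inj ff'); rewrite linearZ linear0 /=.
elim/pquot_ind: (f _) => s; rewrite pquot_scaleE; apply/pquot_eq0.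
by exists s; rewrite mulrC.
Qed.

(** A form of Krull-Schmidt uniqueness. The retraction writes 1 as a sum of terms
    [c s t *: h (E s t)] in a local ring, so in some term both factors are units. There [y ^+ i]
    kills [c s t *: g t], which gives [d t <= i], and [y ^+ d t] kills [h (E s t)], which gives
    [i <= d t]. *)
Lemma retract_power_order M r g d k i : @cyclic_basis M r g d -> (0 < i <= n)%N ->
  retract (pquot (y ^+ i) : lmodType R) {ffun 'I_k -> M} ->
  exists2 t, (t < r)%N & d t = i.
Proof.
move=> bM /andP[i0 iN] [f [h hf]]; have [h1 h2 h3] := bM.
pose w := f (\pi_(pquot (y ^+ i)) 1).
have /choice[c hc] s := h1 (w s).
pose E s t : {ffun 'I_k -> M} := [ffun s' => if s' == s then g t else 0].
have wE : w = \sum_(s < k) \sum_(t < r) c s t *: E s t.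
  apply/ffunP => s; rewrite sum_ffunE (bigD1 s) //= [X in _ + X]big1 ?addr0 => [|s' /negbTE ss'].
    rewrite sum_ffunE hc; apply: eq_bigr => t _; by rewrite !ffunE eqxx.
  by rewrite sum_ffunE big1 // => t _; rewrite !ffunE eq_sym ss' scaler0.
have [[s [t [nc nE]]]|none] := pselect (exists s (t : 'I_r),
    ~ divides y (c s t) /\ ~ divides y (repr (h (E s t)))).
- have [/andP[_ dn] dt0] := h2 t (ltn_ord t).
  exists t => //; apply/eqP; rewrite eqn_leq; apply/andP; split.
    apply: (divides_pow_leq hR) => //; apply: divides_unit_cancel nc _.
    apply: (h3 (fun t => y ^+ i * c s t)) (ltn_ord t).
    under eq_bigr => j _ do rewrite -scalerA.
    rewrite -scaler_sumr -hc; have -> : y ^+ i *: w s = (y ^+ i *: w) s by rewrite ffunE.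
    rewrite /w -linearZ /= pquot_scaleE.
    have -> : \pi_(pquot (y ^+ i)) (y ^+ i * 1) = 0.
      by apply/pquot_eq0; exists 1; rewrite mulrC.
    by rewrite linear0 ffunE.
  apply: (divides_pow_leq hR) => //; apply: divides_unit_cancel nE _.
  apply/pquot_eq0; rewrite -pquot_scaleE reprK -linearZ /=.
  suff -> : y ^+ d t *: E s t = 0 by rewrite linear0.
  by apply/ffunP => s'; rewrite !ffunE; case: eqP; rewrite ?scaler0 ?dt0.
(* Otherwise every term lies in the ideal generated by [y], and so does their sum 1. *)
- case: (not_divides1 hR).
  pose small (u : pquot (y ^+ i)) := exists b, u = \pi_(pquot (y ^+ i)) (b * y).
  have [b eb] : small (\pi 1).
    rewrite -[\pi 1]hf -/w wE linear_sum /small.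
    have sD u v : small u -> small v -> small (u + v).
      by move=> [b ->] [b' ->]; exists (b + b'); rewrite mulrDl pi_pquotD.
    have s0 : small 0 by exists 0; apply/esym/pquot_eq0; exists 0; rewrite !mul0r.
    apply: (big_ind small) => // s _; rewrite linear_sum; apply: (big_ind small) => // t _.
    rewrite linearZ /= -[h _]reprK pquot_scaleE.
    have [[b eb]|nc] := pselect (divides y (c s t)).
      by exists (b * repr (h (E s t))); rewrite eb mulrAC.
    have [[b eb]|nE] := pselect (divides y (repr (h (E s t)))).
      by exists (c s t * b); rewrite eb mulrA.
    by case: none; exists s, t.
  have /asboolP dv : 1 - b * y \in principal (y ^+ i) by apply/pquot_eq.
  have [q eq] : divides y (1 - b * y).
    by rewrite -[X in divides X]expr1; apply: divides_powW dv.
  by exists (q + b); rewrite mulrDl -eq subrK.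
Qed.

(** An indecomposable module in add(M) is cyclic, because any cyclic summand of it has zero
    complement; its order occurs in [d] by [retract_power_order]. *)
Lemma add_eq_orders M r g d l : @cyclic_basis M r g d -> (0 < l <= n)%N ->
  add_eq M (fun i => pquot (y ^+ i) : lmodType R) l <->
  (forall i, (1 <= i <= l)%N <-> exists2 t, (t < r)%N & d t = i).
Proof.
move=> bM /andP[l0 ln]; have [_ h2 _] := bM.
have inadd t : (t < r)%N -> in_add M (pquot (y ^+ d t) : lmodType R).
  move=> tr; apply/in_add_retractP; split; first exact: fin_gen_pquot.
  by exists 1%N; apply: retract_trans (retract_ffun1 M); exact: cyclic_basis_retract bM tr.
split=> [H i|H N].
- split=> [/andP[i1 il]|[t tr <-]].
    have [|/in_add_retractP[_ [k rk]] _] := (H (pquot (y ^+ i) : lmodType R)).2.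
      by exists i; rewrite i1 il; split=> //; apply: mod_iso_refl.
    by apply: (retract_power_order bM _ rk); rewrite i1 (leq_trans il).
  have [dt _] := h2 t tr.
  have mt : in_add M (pquot (y ^+ d t) : lmodType R) /\
      indecomposable (pquot (y ^+ d t) : lmodType R).
    by split; [apply: inadd | apply: pquot_indecomposable].
  have [j [/andP[j1 jl] iso]] := (H _).1 mt.
  by rewrite (pquot_pow_iso dt _ iso) j1 //= (leq_trans jl).
- split=> [[/in_add_retractP[fN [k rk]] iN]|[i [/H[t tr <-] iso]]].
    have [r' [g' [d' bN]]] := exists_cyclic_basis fN.
    have r0 : (0 < r')%N.
      case: r' bN => // -[h _ _]; case: iN => -[] v.
      by have [c ->] := h v; rewrite big_ord0.
    have rt := cyclic_basis_retract bN r0.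
    have [L iL] := retract_complement rt; have iL' := mod_iso_sym iL.
    have [_ h2' _] := bN; have [d0 _] := h2' _ r0.
    exists (d' 0%N); split.
      by apply/H; apply: (retract_power_order bM d0 (retract_trans rt rk)).
    have [_ /(_ _ _ iL')[z|z]] := iN; first by have [/(_ z)] := pquot_indecomposable d0.
    apply: mod_iso_trans iL' _.
    exists (linear_of (@linear_fst R (pquot (y ^+ d' 0%N) : lmodType R) L)), (fun u => (u, 0)) => //.
    by move=> [u v]; rewrite (z v).
  have [dt _] := h2 t tr; have [_ r1] := (in_add_retractP _ _).1 (inadd t tr).
  split; last by apply: indecomposable_iso iso _; apply: pquot_indecomposable.
  apply/in_add_retractP; split; first by apply: fin_gen_iso iso (fin_gen_pquot _).
  by have [k rk] := r1; exists k; apply: retract_trans rk; apply: retract_iso.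
Qed.

End Bases.

(** * Pure surjections *)

Section PureSurjection.
Variables (R : comPzRingType) (y : R) (n : nat) (hR : chain_ring y n).
Variables (X C : lmodType R) (p : {linear C -> X}).
Hypothesis pure : forall i v, (i <= n)%N -> y ^+ i *: v = 0 ->
  exists2 u, y ^+ i *: u = 0 & p u = v.

(* Graphs of sections of [p] over pure submodules.  The conditions do not
   force the graph to be nonempty, so that empty chains need no special care. *)
Definition partial_section (G : set (X * C)) :=
  [/\ forall w w', G w -> G w' -> G (w + w'),
      forall a w, G w -> G (a *: w),
      forall v u, G (v, u) -> p u = v,
      forall u, G (0, u) -> u = 0
    & forall i x u, G (y ^+ i *: x, u) ->
        exists x' u', G (x', u') /\ y ^+ i *: x' = y ^+ i *: x].

Lemma partial_section_bigcup (F : set (set (X * C))) :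
  F `<=` partial_section -> total_on F subset -> partial_section (\bigcup_(G in F) G).
Proof.
move=> FP tot; split.
- move=> w w' [G FG Gw] [G' FG' Gw'].
  have [le|le] := tot _ _ FG FG'.
    by exists G' => //; have [D _ _ _ _] := FP _ FG'; apply: D => //; apply: le.
  by exists G => //; have [D _ _ _ _] := FP _ FG; apply: D => //; apply: le.
- by move=> a w [G FG Gw]; exists G => //; have [_ Z _ _ _] := FP _ FG; apply: Z.
- by move=> v u [G FG Gw]; have [_ _ S _ _] := FP _ FG; apply: S.
- by move=> u [G FG Gw]; have [_ _ _ S _] := FP _ FG; apply: S.
- move=> i x u [G FG Gw]; have [_ _ _ _ S] := FP _ FG.
  by have [x' [u' [Gx' e]]] := S _ _ _ Gw; exists x', u'; split=> //; exists G.
Qed.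

(** An element [z] of maximal order [m.+1] modulo the domain [D] is corrected, by purity of [D], to
    [z1] with [y ^+ m.+1 *: z1 = 0]. A lift [c] of [z1] killed by the same power exists by [pure],
    and the graph is enlarged by the multiples of [(z1, c)]. *)
Lemma partial_section_extend (A : set (X * C)) v0 : partial_section A -> A 0 ->
  (forall u, ~ A (v0, u)) -> exists2 B, A `<` B & partial_section B.
Proof.
move=> [AD AZ Ap A0 Apure] A00 nv0; have [_ yn _ _] := hR.
pose D := [set v | exists u, A (v, u)].
have hD : is_submod D.
  split=> [|v w [u Av] [u' Aw]|a v [u Av]]; first by exists 0.
    by exists (u + u'); apply: (AD (v, u) (w, u')).
  by exists (a *: u); apply: (AZ a (v, u)).
have [D0 DD DZ] := hD.
pose killed m := `[< forall v, D (y ^+ m *: v) >].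
have killedn : killed n by apply/asboolP => v; rewrite yn scale0r.
case: (ex_minnP (ex_intro _ n killedn)) => m /asboolP Dm minm.
have {}mn : (m <= n)%N by apply: minm.
case: m => [|m] in Dm minm mn *.
  by have [u] := Dm v0; rewrite scale1r => /nv0.
have [z nz] : exists z, ~ D (y ^+ m *: z).
  apply: contrapT => H; suff : (m.+1 <= m)%N by rewrite ltnn.
  by apply: minm; apply/asboolP => v; apply: contrapT => nD; apply: H; exists v.
have [u Au] := Dm z; have [x' [u' [Ax' ex']]] := Apure _ _ _ Au.
pose z1 := z - x'; have Dx' : D x' by exists u'.
have nz1 : ~ D (y ^+ m *: z1).
  move=> h; apply: nz; rewrite -[z](subrK x') scalerDr.
  by apply: DD => //; apply: DZ.
have [|c yc pc] := @pure m.+1 z1 mn.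
  by rewrite scalerBr ex' subrr.
pose B := [set w | exists v u r, A (v, u) /\ w = (v + r *: z1, u + r *: c)].
have AB w : A w -> B w.
  by case: w => v w Aw; exists v, w, 0; rewrite !scale0r !addr0.
have Bz1 : B (z1, c) by exists 0, 0, 1; rewrite !scale1r !add0r.
exists B.
  by split=> [w /AB //|BA]; apply: nz1; apply: (DZ); exists c; apply: BA.
split.
- move=> _ _ [v [w [r [Aw ->]]]] [v' [w' [r' [Aw' ->]]]].
  exists (v + v'), (w + w'), (r + r'); split; first exact: (AD (v, w) (v', w')).
  by congr pair; rewrite /= scalerDl addrACA.
- move=> a _ [v [w [r [Aw ->]]]]; exists (a *: v), (a *: w), (a * r).
  split; first exact: (AZ a (v, w)).
  by congr pair; rewrite /= scalerDr scalerA.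
- by move=> _ _ [v [w [r [Aw [-> ->]]]]]; rewrite linearD linearZ /= (Ap _ _ Aw) pc.
- move=> _ [v [w [r [Aw [/esym/eqP + ->]]]]]; rewrite addr_eq0 => /eqP ev.
  (* As [r *: z1] lies in [D], [r] is a multiple of [y ^+ m.+1], so both [r *: z1] and [r *: c]
     vanish. *)
  have [b eb] : divides (y ^+ m.+1) r.
    apply: (divides_annihilator hR hD nz1); rewrite -[r *: z1]opprK -ev.
    by rewrite -scaleN1r; apply: DZ; exists w.
  have rz : r *: z1 = 0 by rewrite eb -scalerA scalerBr ex' subrr scaler0.
  rewrite {1}eb -scalerA yc scaler0 addr0; apply: A0.
  by rewrite -[0]oppr0 -rz -ev.
- move=> i x _ [v [w [r [Aw [ev _]]]]].
  (* For [i > m] the element [y ^+ i *: x] is already in [D]. Otherwise [y ^+ i] divides [r], and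
     subtracting a multiple of [z1] from [x] reduces to purity of [D]. *)
  have [mi|im] := leqP m.+1 i.
    have [w' Aw'] : D (y ^+ i *: x).
      by rewrite -(subnK mi) exprD -scalerA; apply: DZ.
    by have [x1 [u1 [Ax1 e1]]] := Apure _ _ _ Aw'; exists x1, u1; split=> //; apply: AB.
  have im' : (i <= m.+1)%N := ltnW im.
  have [||b eb] := @divides_pow_cancel _ y n hR (m.+1 - i) i r.
  - by rewrite subnK.
  - rewrite subnK //; apply: (divides_annihilator hR hD nz1).
    have -> : (y ^+ (m.+1 - i) * r) *: z1 = y ^+ m.+1 *: x - y ^+ (m.+1 - i) *: v.
      have -> : y ^+ m.+1 = y ^+ (m.+1 - i) * y ^+ i by rewrite -exprD subnK.
      by rewrite -!scalerA ev -scalerBr addrAC subrr add0r.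
    by apply: is_submodB => //; apply: DZ; exists w.
  have {}ev : v = y ^+ i *: (x - b *: z1).
    by rewrite scalerBr ev eb scalerA mulrC addrK.
  rewrite ev in Aw; have [x1 [u1 [Ax1 e1]]] := Apure _ _ _ Aw.
  exists (x1 + b *: z1), (u1 + b *: c); split; first by exists x1, u1, b.
  by rewrite scalerDr e1 -scalerDr subrK.
Qed.

Lemma pure_surjection_splits : exists s : {linear X -> C}, cancel s p.
Proof.
have [A [PA maxA]] := Zorn_bigcup partial_section_bigcup.
have [AD AZ Ap A0 _] := PA.
(* The empty graph is not maximal, as it lies strictly below the graph consisting of 0. *)
have A00 : A 0.
  apply: contrapT => nA.
  have empty w : ~ A w by move=> Aw; apply: nA; rewrite -[0](scale0r w); apply: AZ.
  apply: (maxA [set 0]); first by split=> [w /empty //|h]; apply: nA; apply: h.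
  split.
  - by move=> _ _ -> ->; rewrite /= addr0.
  - by move=> a _ ->; rewrite /= scaler0.
  - by move=> v u [-> ->]; rewrite linear0.
  - by move=> u [].
  - by move=> i x u [e _]; exists 0, 0; rewrite scaler0 e.
have /choice[s hs] : forall v, exists u, A (v, u).
  move=> v; apply: contrapT => h.
  have [|B AB PB] := @partial_section_extend A v PA A00.
    by move=> u Au; apply: h; exists u.
  exact: (maxA B).
have l : linear s.
  move=> a u v; apply/eqP; rewrite -subr_eq0; apply/eqP/A0.
  have h1 := AD _ _ (AZ a _ (hs u)) (hs v).
  have := AD _ _ (hs (a *: u + v)) (AZ (-1) _ h1); rewrite scaleN1r.
  by move=> h; apply: (eq_ind _ A h); congr pair; rewrite /= subrr.
by exists (linear_of l) => v; apply: Ap.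
Qed.

End PureSurjection.

(** * Modules over the endomorphism ring *)

Section EndomorphismModule.
Variables (R : pzRingType) (M : lmodType R).

(** A synonym of [M] that carries the evaluation action of End(M) beside the action of [R] on
    [M]. *)
Definition emod : Type := M.
HB.instance Definition _ := GRing.Zmodule.on emod.

Definition emod_scale (f : endo M) (v : emod) : emod := f v.
Fact emod_scaleA f f' v : emod_scale f (emod_scale f' v) = emod_scale (f * f') v.
Proof. by []. Qed.
Fact emod_scale1 : left_id 1 emod_scale. Proof. by []. Qed.
Fact emod_scaleDr : right_distributive emod_scale +%R.
Proof. by move=> f u v; apply: (linearD (f : {linear M -> M})). Qed.
Fact emod_scaleDl v : {morph emod_scale^~ v : f f' / f + f'}.
Proof. by []. Qed.
HB.instance Definition _ := GRing.Zmodule_isLmodule.Build (endo M) emod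
  emod_scaleA emod_scale1 emod_scaleDr emod_scaleDl.

Lemma endoMv (f f' : endo M) v : endo_fun (f * f') v = f (f' v). Proof. by []. Qed.
Lemma endoDv (f f' : endo M) v : endo_fun (f + f') v = f v + f' v. Proof. by []. Qed.
Lemma endo_sumv I (s : seq I) (P : pred I) (F : I -> endo M) v :
  endo_fun (\sum_(i <- s | P i) F i) v = \sum_(i <- s | P i) F i v.
Proof. by elim/big_rec2: _ => // i a b _ <-. Qed.
Lemma endo_lin (f : endo M) : linear f.
Proof. exact: (linearP (f : {linear M -> M})). Qed.
Lemma endo0 (f : endo M) : f 0 = 0.
Proof. exact: (linear0 (f : {linear M -> M})). Qed.
Lemma endoZ (f : endo M) a v : f (a *: v) = a *: f v.
Proof. exact: (linearZ_LR (f : {linear M -> M})). Qed.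
Lemma endo_sum (f : endo M) I (s : seq I) (P : pred I) (F : I -> M) :
  f (\sum_(i <- s | P i) F i) = \sum_(i <- s | P i) f (F i).
Proof. exact: (linear_sum (f : {linear M -> M})). Qed.

End EndomorphismModule.

Section Scalars.
Variables (R : comPzRingType) (M : lmodType R).

Fact homothety_linear (a : R) : linear (fun v : M => a *: v).
Proof. by move=> b u v; rewrite scalerDr !scalerA mulrC. Qed.
Definition homothety (a : R) : endo M := linear_of (homothety_linear a).

Lemma homothetyE a v : homothety a v = a *: v. Proof. by []. Qed.
Lemma homothetyM a b : homothety (a * b) = homothety a * homothety b.
Proof. by apply: endoP => v; rewrite endoMv !homothetyE scalerA. Qed.
Lemma homothetyD a b : homothety (a + b) = homothety a + homothety b.
Proof. by apply: endoP => v; rewrite endoDv !homothetyE scalerDl. Qed.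
Lemma homothety1 : homothety 1 = 1.
Proof. by apply: endoP => v; rewrite homothetyE scale1r. Qed.
Lemma homothetyC a (f : endo M) : homothety a * f = f * homothety a.
Proof. by apply: endoP => v; rewrite !endoMv !homothetyE endoZ. Qed.

Variable N : lmodType (endo M).

(** Restriction of scalars along [homothety], through which splittings over [R] are applied to
    modules over End(M). *)
Definition resmod : Type := N.
HB.instance Definition _ := GRing.Zmodule.on resmod.
Definition resmod_scale (a : R) (v : resmod) : resmod := homothety a *: (v : N).
Fact resmod_scaleA a b v : resmod_scale a (resmod_scale b v) = resmod_scale (a * b) v.
Proof. by rewrite /resmod_scale scalerA homothetyM. Qed.
Fact resmod_scale1 : left_id 1 resmod_scale.
Proof. by move=> v; rewrite /resmod_scale homothety1 scale1r. Qed.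
Fact resmod_scaleDr : right_distributive resmod_scale +%R.
Proof. by move=> a u v; apply: scalerDr. Qed.
Fact resmod_scaleDl v : {morph resmod_scale^~ v : a b / a + b}.
Proof. by move=> a b; rewrite /resmod_scale homothetyD scalerDl. Qed.
HB.instance Definition _ := GRing.Zmodule_isLmodule.Build R resmod
  resmod_scaleA resmod_scale1 resmod_scaleDr resmod_scaleDl.

End Scalars.

(** * The corner of End(M) at a summand of maximal order *)

Section Corner.
Variables (R : comPzRingType) (y : R) (n : nat) (hR : chain_ring y n).
Variables (M : lmodType R) (r : nat) (g : nat -> M) (d : nat -> nat).
Hypothesis bM : cyclic_basis y n r g d.
Variable t0 : nat.
Hypotheses (t0r : (t0 < r)%N) (dmax : forall t, (t < r)%N -> (d t <= d t0)%N).
Local Notation l := (d t0).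
Local Notation A := (endo M).
Local Notation "a %:h" := (homothety M a) (at level 2, format "a %:h").

Lemma endo_basis_eq (f f' : A) : (forall t, (t < r)%N -> f (g t) = f' (g t)) -> f = f'.
Proof.
move=> h; apply: endoP => v; have [/(_ v)[c ->] _ _] := bM.
by rewrite !endo_sum; apply: eq_bigr => t _; rewrite !endoZ h.
Qed.

Lemma exists_endo (u : nat -> M) : (forall t, (t < r)%N -> y ^+ d t *: u t = 0) ->
  exists f : A, forall t, (t < r)%N -> f (g t) = u t.
Proof. by move=> /(cyclic_basis_lin bM)[f hf]; exists f. Qed.

Lemma max_le_n : (l <= n)%N.
Proof. by have [_ /(_ _ t0r)[/andP[]]] := bM. Qed.

(* [alpha t] is the projection of M onto its t-th summand followed by the
   embedding of that summand into the one of maximal length l; these maps span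
   the A-module e A = Hom(M, R/(y^l)) over R, where e = alpha t0. *)
Definition is_alpha (alpha : nat -> A) := forall t s, (t < r)%N -> (s < r)%N ->
  alpha t (g s) = if s == t then y ^+ (l - d t) *: g t0 else 0.

Lemma exists_alpha : exists alpha, is_alpha alpha.
Proof.
have /choice[alpha h] t : exists f : A, (t < r)%N -> forall s, (s < r)%N ->
    f (g s) = if s == t then y ^+ (l - d t) *: g t0 else 0.
  case tr: (t < r)%N; last by exists 0.
  have [|f hf] := @exists_endo (fun s => if s == t then y ^+ (l - d t) *: g t0 else 0).
    move=> s sr; case: eqP => [->|_]; last by rewrite scaler0.
    rewrite scalerA -exprD subnKC ?dmax //.
    by have [_ /(_ _ t0r)[]] := bM.
  by exists f.
by exists alpha => t s tr; apply: h.
Qed.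

Variables (alpha : nat -> A) (ha : is_alpha alpha).
Local Notation e := (alpha t0).

Lemma alpha_sum t c : (t < r)%N ->
  alpha t (\sum_(s < r) c (s : nat) *: g s) = (c t * y ^+ (l - d t)) *: g t0.
Proof.
move=> tr; rewrite endo_sum (bigD1 (Ordinal tr)) //= endoZ ha // eqxx scalerA.
rewrite big1 ?addr0 // => s; rewrite -val_eqE /= => /negbTE st.
by rewrite endoZ ha // st scaler0.
Qed.

Lemma e_top : e (g t0) = g t0.
Proof. by rewrite ha // eqxx subnn scale1r. Qed.

Lemma e_image v : exists c, e v = c *: g t0.
Proof.
have [/(_ v)[c ->] _ _] := bM.
by exists (c t0); rewrite alpha_sum // subnn mulr1.
Qed.

Lemma e_alpha t : (t < r)%N -> e * alpha t = alpha t.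
Proof.
move=> tr; apply: endo_basis_eq => s sr; rewrite endoMv ha //.
by case: eqP => _; rewrite ?endoZ ?e_top ?endo0.
Qed.

Lemma alpha_killed t : (t < r)%N -> (y ^+ d t)%:h * alpha t = 0.
Proof.
move=> tr; apply: endo_basis_eq => s sr; rewrite endoMv homothetyE ha //.
case: eqP => _; last exact: scaler0.
rewrite scalerA -exprD subnKC ?dmax //.
by have [_ /(_ _ t0r)[]] := bM.
Qed.

(** The element [alpha t (a (g s))] is a multiple of [g t0] killed by [y ^+ d s], hence a multiple
    of [y ^+ (l - d s) *: g t0 = alpha s (g s)]. *)
Lemma alpha_span t (a : A) : (t < r)%N ->
  exists c, alpha t * a = \sum_(s < r) (c (s : nat))%:h * alpha s.
Proof.
move=> tr; have /choice[c hc] s : exists c, (s < r)%N ->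
    alpha t (a (g s)) = (c * y ^+ (l - d s)) *: g t0.
  case sr: (s < r)%N; last by exists 0.
  have [c ec] := e_image (alpha t (a (g s))).
  rewrite -endoMv e_alpha // in ec.
  have [||b eb] := @divides_pow_cancel _ y n hR (d s) (l - d s) c.
  - by rewrite subnKC ?dmax // max_le_n.
  - rewrite subnKC ?dmax //; apply/(cyclic_basis_eq0 _ bM t0r).
    rewrite -scalerA -ec -!endoZ; have [_ /(_ _ sr)[_ ->]] := bM.
    by rewrite !endo0.
  by exists b => _; rewrite ec eb.
exists c; apply: endo_basis_eq => s sr; rewrite endo_sumv endoMv hc //.
rewrite (bigD1 (Ordinal sr)) // endoMv homothetyE ha // eqxx scalerA.
rewrite big1 => [|s' st]; first exact/esym/addr0.
have /negbTE ss : (s' != s :> nat) := st.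
by rewrite endoMv homothetyE ha // eq_sym ss scaler0.
Qed.

(** Since the [alpha t] span e A over [R], this is injectivity of the canonical map from [N] to
    Hom_R(e A, e N). *)
Definition alpha_faithful (N : lmodType A) :=
  forall w : N, (forall t, (t < r)%N -> alpha t *: w = 0) -> w = 0.

(* N is recovered from the R-module e N as Hom(M*, e N); for A itself this is
   e A = Hom(M, R/(y^l)) and A = End(M). *)
Definition alpha_exact (N : lmodType A) := alpha_faithful N /\
  forall z : nat -> N,
    (forall t, (t < r)%N -> e *: z t = z t /\ (y ^+ d t)%:h *: z t = 0) ->
    exists w, forall t, (t < r)%N -> alpha t *: w = z t.

Lemma alpha_faithful_inj (N : lmodType A) (u v : N) : alpha_faithful N ->
  (forall t, (t < r)%N -> alpha t *: u = alpha t *: v) -> u = v.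
Proof.
move=> fN h; apply/eqP; rewrite -subr_eq0; apply/eqP/fN => t tr.
by rewrite scalerBr h // subrr.
Qed.

(** [alpha t] reads off the coordinate [c t] as [(c t * y ^+ (l - d t)) *: g t0]. This determines
    [c t] modulo [y ^+ d t], and every multiple of [g t0] killed by [y ^+ d t] has this shape. *)
Lemma alpha_exact_emod : alpha_exact (emod M).
Proof.
have [h1 h2 h3] := bM; split=> [w|z hz].
  have [c ->] := h1 w => h; apply: big1 => t _; have tr := ltn_ord t.
  have := h t tr; rewrite /GRing.scale /= /emod_scale alpha_sum //.
  move=> /(cyclic_basis_eq0 _ bM t0r); rewrite mulrC -{1}(subnK (dmax tr)).
  move=> /(divides_pow_cancel hR); rewrite subnK ?dmax // max_le_n => /(_ isT).
  by move=> /(cyclic_basis_eq0 _ bM tr).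
have /choice[c hc] t : exists c, (t < r)%N -> z t = (c * y ^+ (l - d t)) *: g t0.
  case tr: (t < r)%N; last by exists 0.
  have [ez yz] := hz t tr; have [c ec] := e_image (z t).
  rewrite [e _]ez in ec.
  have [||b eb] := @divides_pow_cancel _ y n hR (d t) (l - d t) c.
  - by rewrite subnKC ?dmax // max_le_n.
  - rewrite subnKC ?dmax //; apply/(cyclic_basis_eq0 _ bM t0r).
    by rewrite -scalerA -ec; exact: yz.
  by exists b => _; rewrite ec eb.
exists (\sum_(t < r) c t *: g t) => t tr; rewrite hc //; exact: alpha_sum.
Qed.

(** Both conditions are inherited pointwise from [M]; uniqueness makes the pointwise solution
    linear. *)
Lemma alpha_exact_regular : alpha_exact (A^o : lmodType A).
Proof.
have [inj surj] := alpha_exact_emod; split=> [w h|z hz].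
  apply: endoP => v; apply: inj => t tr.
  by have := congr1 (fun f : A => f v) (h t tr).
have /choice[w hw] v : exists w : M, forall t, (t < r)%N -> alpha t w = (z t : A) v.
  apply: (surj (fun t => (z t : A) v)) => t tr; have [h1 h2] := hz t tr.
  by split; [have := congr1 (fun f : A => f v) h1 | have := congr1 (fun f : A => f v) h2].
have lw : linear w.
  move=> a u v; apply: (alpha_faithful_inj inj) => t tr.
  rewrite -[LHS]/(alpha t _) hw // endo_lin -!hw //.
  exact/esym/(endo_lin (alpha t)).
exists (linear_of lw : A) => t tr; apply: endoP => v; exact: hw.
Qed.

Lemma alpha_exact_freemod (I : choiceType) : alpha_exact (freemod A I : lmodType A).
Proof.
have [inj surj] := alpha_exact_regular; split=> [w h|z hz].
  apply: val_inj; apply/funext => i; apply: inj => t tr.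
  by rewrite -freemod_valZ h // freemod_val0.
have /choice[w hw] i : exists w : A^o, forall t, (t < r)%N -> alpha t *: w = val (z t) i.
  apply: (surj (fun t => val (z t) i)) => t tr; have [h1 h2] := hz t tr.
  by rewrite -!freemod_valZ h1 h2 freemod_val0.
(* The support of [w] lies in the union of the supports of the finitely many [z t]. *)
have fw : finitely_supported w.
  have : finite_set (\bigcup_(t in `I_r) [set i | val (z t) i != 0]).
    by apply: bigcup_finite => [|t _]; [apply: finite_II | apply: (submodP (z t))].
  apply: sub_finite_set => i /= wi; apply: contrapT => h; case/eqP: wi.
  apply: inj => t tr; rewrite hw //; apply: contrapT => zi; apply: h.
  by exists t => //; apply/eqP.
exists (to_submod (finitely_supported_submod A I) fw) => t tr.
by apply: val_inj; apply/funext => i; rewrite freemod_valZ -hw.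
Qed.

Lemma alpha_faithful_submod (N : lmodType A) (P : set N) (hP : is_submod P) :
  alpha_faithful N -> alpha_faithful (submod hP).
Proof.
move=> fN w h; apply: val_inj; apply: fN => t tr.
by have := congr1 val (h t tr).
Qed.

(** A solution [w] found in [Q] lies in the kernel: each [alpha t] kills [p w], and [N] is
    faithful. *)
Lemma alpha_exact_kernel (Q N : lmodType A) (p : {linear Q -> N}) :
  alpha_exact Q -> alpha_faithful N -> alpha_exact (submod (kernel_is_submod p)).
Proof.
move=> [fQ sQ] fN; split; first exact: alpha_faithful_submod.
move=> z hz; have [|w hw] := sQ (fun t => val (z t)).
  move=> t tr; have [h1 h2] := hz t tr.
  by split; [have := congr1 val h1 | have := congr1 val h2].
have pw : p w = 0.
  by apply: fN => t tr; rewrite -linearZ /= hw // (submodP (z t)).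
exists (to_submod (kernel_is_submod p) pw) => t tr; apply: val_inj; exact: hw.
Qed.

End Corner.

Lemma freemod_lin_surj (A : pzRingType) (N : lmodType A) v :
  exists u, freemod_lin (fun w : N => w) u = v.
Proof. by exists (freemod_delta A v); rewrite freemod_lin_delta. Qed.

Lemma regular_projective (A : pzRingType) : projective (A^o : lmodType A).
Proof.
move=> U V q f qs; have [u qu] := qs (f 1).
have lh : linear (fun a : A^o => (a : A) *: u).
  by move=> a b c; rewrite scalerDl scalerA.
exists (linear_of lh) => a; rewrite /= linearZ /= qu -linearZ.
by congr (f _); apply: mulr1.
Qed.

(** * Bounds on projective dimension *)

Section GlobalDimensionBounds.
Variables (R : comPzRingType) (y : R) (n : nat) (hR : chain_ring y n).
Variables (M : lmodType R) (r : nat) (g : nat -> M) (d : nat -> nat).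
Hypothesis bM : cyclic_basis y n r g d.
Variable t0 : nat.
Hypotheses (t0r : (t0 < r)%N) (dmax : forall t, (t < r)%N -> (d t <= d t0)%N).
Local Notation l := (d t0).
Local Notation A := (endo M).
Local Notation "a %:h" := (homothety M a) (at level 2, format "a %:h").

Lemma homothety_scaleC (N : lmodType A) a (f : A) (v : N) :
  a%:h *: (f *: v) = f *: (a%:h *: v).
Proof. by rewrite !scalerA homothetyC. Qed.

Lemma homothety_pow_le (N : lmodType A) i j (v : N) : (i <= j)%N ->
  (y ^+ i)%:h *: v = 0 -> (y ^+ j)%:h *: v = 0.
Proof.
by move=> ij h; rewrite -(subnK ij) exprD homothetyM -scalerA h scaler0.
Qed.

Section FullOrders.
Hypothesis full : forall i, (0 < i <= l)%N -> exists2 t, (t < r)%N & d t = i.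
Variables (alpha : nat -> A) (ha : is_alpha y r g d t0 alpha).
Local Notation e := (alpha t0).
Local Notation faithful := (alpha_faithful r alpha).
Local Notation exact_mod := (alpha_exact y r d t0 alpha).

(** The components [alpha t *: v] are lifted separately. Such a component is killed by [y] to the
    power [minn (d t) i], and by [full] some [t'] has exactly this order. Exactness of [K] yields
    [x] with this component in place [t']; for a preimage [x'] of [x], the element [alpha t' *: x']
    is a lift killed by the same power. Exactness of [P] assembles the lifts. *)
Lemma alpha_exact_pure (P K : lmodType A) (p : {linear P -> K}) :
  exact_mod P -> exact_mod K -> (forall v, exists u, p u = v) ->
  forall i v, (y ^+ i)%:h *: v = 0 -> exists2 u, (y ^+ i)%:h *: u = 0 & p u = v.
Proof.
move=> [fP sP] [fK sK] ps i v yv.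
have [i0|i0] := posnP i.
  exists 0; first by rewrite scaler0.
  by move: yv; rewrite i0 expr0 homothety1 scale1r => ->; rewrite linear0.
have /choice[z hz] t : exists z : P, (t < r)%N ->
    [/\ e *: z = z, (y ^+ d t)%:h *: z = 0, (y ^+ i)%:h *: z = 0
      & p z = alpha t *: v].
  case tr: (t < r)%N; last by exists 0.
  have [_ /(_ _ tr)[/andP[dt0 _] _] _] := bM.
  have [|t' tr' dt'] := full (i := minn (d t) i).
    by rewrite leq_min dt0 i0 geq_min dmax.
  have yat : (y ^+ d t)%:h *: (alpha t *: v) = 0.
    by rewrite scalerA (alpha_killed bM t0r dmax ha) // scale0r.
  have yai : (y ^+ i)%:h *: (alpha t *: v) = 0 by rewrite homothety_scaleC yv scaler0.
  have [|x hx] := sK (fun s => if s == t' then alpha t *: v else 0).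
    move=> s sr; case: eqP => [->|_]; last by rewrite !scaler0.
    rewrite scalerA (e_alpha bM t0r ha) //; split=> //.
    by rewrite dt' /minn; case: ifP.
  have [x' px'] := ps x.
  exists (alpha t' *: x') => _.
  have yx j : (minn (d t) i <= j)%N -> (y ^+ j)%:h *: (alpha t' *: x') = 0.
    rewrite -dt' => /homothety_pow_le; apply.
    by rewrite scalerA (alpha_killed bM t0r dmax ha) // scale0r.
  split; [by rewrite scalerA (e_alpha bM t0r ha)|apply: yx|apply: yx|].
  - exact: geq_minl.
  - exact: geq_minr.
  - by rewrite linearZ /= px' hx // eqxx.
have [t tr|u hu] := sP z; first by have [] := hz t tr.
exists u.
  apply: fP => t tr; rewrite -homothety_scaleC hu //.
  by have [] := hz t tr.
apply: (alpha_faithful_inj fK) => t tr; rewrite -linearZ /= hu //.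
by have [] := hz t tr.
Qed.

(* An R-linear section s of a free cover of K is turned into the A-linear one
   v |-> w with alpha t w = e s (alpha t v). *)
Lemma alpha_exact_projective (K : lmodType A) : exact_mod K -> projective K.
Proof.
move=> xK; pose P : lmodType A := freemod A K.
pose p : {linear P -> K} := freemod_lin (fun v : K => v).
have ps := freemod_lin_surj (N := K).
have xP : exact_mod P := alpha_exact_freemod hR bM t0r dmax ha K.
have [fP sP] := xP; have [fK _] := xK.
have lp : linear (p : resmod P -> resmod K).
  by move=> a u v; rewrite -[a *: u]/((a%:h) *: (u : P)) linearP.
have [|s ps'] := @pure_surjection_splits R y n hR (resmod K) (resmod P) (linear_of lp).
  by move=> i v _; apply: (alpha_exact_pure xP xK ps).
have pZ a u : p (a *: u) = a *: p u by apply: linearZ_LR.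
have sD u v : s (u + v) = s u + s v by apply: linearD.
have sZ a u : s (a%:h *: (u : K)) = a%:h *: (s u : P) by apply: (linearZ_LR s).
have s0 : s 0 = 0 := linear0 s.
have sS (F : 'I_r -> K) : s (\sum_(i < r) F i) = \sum_(i < r) (s (F i) : P).
  exact: (linear_sum s).
have /choice[S hS] v : exists w : P, forall t, (t < r)%N ->
    alpha t *: w = e *: (s (alpha t *: v) : P).
  apply: (sP (fun t => e *: (s (alpha t *: v) : P))) => t tr.
  rewrite scalerA (e_alpha bM t0r ha) // homothety_scaleC -sZ scalerA.
  by rewrite (alpha_killed bM t0r dmax ha) // scale0r s0 scaler0.
have lS : linear S.
  move=> a u v; apply: (alpha_faithful_inj fP) => t tr.
  rewrite scalerDr scalerA hS // scalerDr scalerA sD scalerDr hS //; congr (_ + _).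
  have [c ->] := alpha_span hR bM t0r dmax ha a tr.
  rewrite !scaler_suml sS scaler_sumr; apply: eq_bigr => i _.
  by rewrite -!scalerA sZ hS // homothety_scaleC.
apply: projective_retract (@freemod_projective A K).
exists (linear_of lS), p => v; apply: (alpha_faithful_inj fK) => t tr.
rewrite -pZ -[linear_of lS v]/(S v) hS // pZ.
by rewrite [p _]ps' scalerA (e_alpha bM t0r ha).
Qed.

(** The first syzygy lies in a free module and is therefore faithful; hence the second one, a kernel
    of a map from a free module to it, is exact and so projective. *)
Lemma proj_resolution2 (N : lmodType A) : proj_resolution N 2.
Proof.
pose K : lmodType A := submod (kernel_is_submod (freemod_lin (fun w : N => w))).
have e0 := kernel_short_exact (freemod_lin_surj (N := N)).
apply: proj_resolutionS (@freemod_projective A N) e0 _.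
have e1 := kernel_short_exact (freemod_lin_surj (N := K)).
apply: proj_resolutionS (@freemod_projective A K) e1 _.
apply: proj_resolution0; apply: alpha_exact_projective.
apply: alpha_exact_kernel; first exact: (alpha_exact_freemod hR bM t0r dmax ha K).
apply: alpha_faithful_submod.
by have [] := alpha_exact_freemod hR bM t0r dmax ha N.
Qed.

(** When all orders are 1, the embeddings [beta t] of the summand at [t0] into the others satisfy
    [\sum_t beta t * alpha t = 1], while [alpha t * beta s * e] is [e] or 0 according as [s = t].
    Hence [w] is recovered as the sum of the [beta s *: z s]. *)
Lemma alpha_exact_simple (N : lmodType A) : l = 1%N -> exact_mod N.
Proof.
move=> l1.
have d1 t : (t < r)%N -> d t = 1%N.
  move=> tr; have [_ /(_ _ tr)[/andP[d0 _] _] _] := bM.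
  by apply/eqP; rewrite eqn_leq d0 -l1 dmax.
have hat t s : (t < r)%N -> (s < r)%N -> alpha t (g s) = if s == t then g t0 else 0.
  by move=> tr sr; rewrite ha // l1 d1 // subnn scale1r.
have /choice[beta hb] t : exists f : A, (t < r)%N -> forall s, (s < r)%N ->
    f (g s) = if s == t0 then g t else 0.
  case tr: (t < r)%N; last by exists 0.
  have [|f hf] := @exists_endo _ _ _ _ _ _ _ bM (fun s => if s == t0 then g t else 0).
    move=> s sr; case: eqP => [->|_]; last by rewrite scaler0.
    by rewrite l1 -(d1 t tr); have [_ /(_ _ tr)[_ ->]] := bM.
  by exists f.
have one : 1 = \sum_(t < r) beta t * alpha t.
  apply: (endo_basis_eq bM) => s sr; rewrite endo_sumv (bigD1 (Ordinal sr)) //.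
  rewrite endoMv hat // eqxx hb // eqxx big1 => [|t ts]; first exact/esym/addr0.
  have /negbTE ts' : (t != s :> nat) := ts.
  by rewrite endoMv hat // eq_sym ts' endo0.
split=> [w h|z hz].
  rewrite -[w]scale1r one scaler_suml big1 // => t _.
  by rewrite -scalerA h // scaler0.
exists (\sum_(s < r) beta s *: z s) => t tr.
have ab s : (s < r)%N -> alpha t *: (beta s *: z s) = if s == t then z t else 0.
  move=> sr; have [ez _] := hz s sr; rewrite -ez !scalerA.
  have -> : alpha t * beta s * e = if s == t then e else 0.
    apply: (endo_basis_eq bM) => u ur; rewrite !endoMv hat //.
    case: (eqVneq u t0) => [->|ut]; last first.
      by rewrite !endo0; case: eqP => // _; rewrite hat // (negbTE ut).
    rewrite hb // eqxx hat //; case: eqP => // _; by rewrite hat // eqxx.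
  by case: eqP => [est|_]; rewrite ?scale0r // ez est.
rewrite scaler_sumr (bigD1 (Ordinal tr)) //= ab // eqxx big1 ?addr0 // => s.
by rewrite -val_eqE /= ab // => /negbTE ->.
Qed.

End FullOrders.

(** The module is A/yA. A resolution of length one makes yA projective, so multiplication by [y]
    from A onto yA has a section [s]. *)
Lemma proj_resolution_pow2 : (1 < l)%N ->
  exists N : lmodType A, ~ proj_resolution N 1.
Proof.
move=> l1; pose T := [set a : A^o | exists b : A, a = y%:h * b].
have hT : is_submod T.
  split=> [|u v [b ->] [c ->]|a v [b ->]].
  - by exists 0; rewrite mulr0.
  - by exists (b + c); rewrite mulrDr.
  - by exists ((a : A) * b); rewrite -[LHS]/((a : A) * (y%:h * b)) !mulrA homothetyC.
exists (quotmod hT) => res.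
have [N1 res1 sr] := proj_resolution_syzygy res (stable_retract_refl _)
  (@regular_projective A) (quotmod_short_exact hT).
have pT := stable_retract_proj sr (proj_resolution0_inv res1).
have lm : linear (fun a : A^o => to_submod hT (ex_intro (fun b => y%:h * a = y%:h * b) a erefl)).
  move=> a b c; apply: val_inj; rewrite /= mulrDr; congr (_ + _).
  by rewrite mulrA homothetyC -mulrA.
have [|s hs] := pT _ _ (linear_of lm) (idfun : {linear _ -> _}).
  by move=> v; have [b eb] := submodP v; exists b; apply: val_inj.
pose u := to_submod hT (ex_intro (fun b => y%:h * 1 = y%:h * b) 1 erefl).
have yb : y%:h * (s u : A) = y%:h by have := congr1 val (hs u); rewrite /= mulr1.
have [_ yn _ _] := hR.
(* Applying [s] to [y ^+ k.+1 *: u = 0], where [u] is [y] in yA, and using [y * s u = y] lowers the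
   vanishing power by one. *)
have step k : (y ^+ k.+2)%:h = 0 -> (y ^+ k.+1)%:h = 0.
  move=> h; have : (y ^+ k.+1)%:h *: u = 0.
    apply: val_inj; rewrite /= -[LHS]/((y ^+ k.+1)%:h * (y%:h * 1)) mulr1 -homothetyM.
    by rewrite -exprSr h.
  move=> /(congr1 s); rewrite linear0 linearZ /= => su.
  have : (y ^+ k)%:h * (y%:h * s u) = 0 by rewrite mulrA -homothetyM -exprSr.
  by rewrite yb -homothetyM -exprSr.
have y0 : y%:h = 0.
  (* Starting from the exponent [n.+1] makes the descent on [n] end at the first power of [y]. *)
  suff : (y ^+ n.+1)%:h = 0 by elim: n => [|k IH]; [rewrite expr1|move=> /step].
  by rewrite exprS yn mulr0; apply: endoP => v; apply: scale0r.
have : y *: g t0 = 0 by have := congr1 (fun f : A => f (g t0)) y0.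
rewrite -[y]expr1 => /(cyclic_basis_eq0 _ bM t0r).
move=> /(divides_pow_leq hR) ; rewrite (max_le_n bM t0r) => /(_ isT).
by rewrite leqNgt l1.
Qed.

End GlobalDimensionBounds.

(** * Missing orders *)

Section Gap.
Variables (R : comPzRingType) (y : R) (n : nat) (hR : chain_ring y n).
Variables (M : lmodType R) (r : nat) (g : nat -> M) (d : nat -> nat).
Hypothesis bM : cyclic_basis y n r g d.
Variable t0 : nat.
Hypotheses (t0r : (t0 < r)%N) (dmax : forall t, (t < r)%N -> (d t <= d t0)%N).
Local Notation l := (d t0).
Local Notation A := (endo M).
Local Notation "a %:h" := (homothety M a) (at level 2, format "a %:h").

Definition killed_by i : set (emod M) := [set v | (y ^+ i)%:h *: v = 0].

Lemma killed_by_submod i : is_submod (killed_by i).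
Proof.
split=> [|u v hu hv|a v hv]; rewrite /killed_by /=.
- exact: scaler0.
- by rewrite scalerDr hu hv addr0.
- by rewrite homothety_scaleC hv scaler0.
Qed.

(* T i is Hom_R(R/(y^i), M). *)
Local Notation T i := (submod (killed_by_submod i) : lmodType A).

(** Evaluation at [g t] maps A onto this module; it is split by sending [m] to the endomorphism with
    [g t] going to [m] and the other generators to 0. *)
Lemma killed_projective t : (t < r)%N -> projective (T (d t)).
Proof.
move=> tr; apply: (projective_retract (N := (A^o : lmodType A))); last first.
  exact: regular_projective.
have /choice[F hF] (m : T (d t)) : exists f : A, forall s, (s < r)%N ->
    f (g s) = if s == t then (val m : M) else 0.
  apply: (exists_endo bM (u := fun s => if s == t then (val m : M) else 0)) => s sr.
  by case: eqP => [->|_]; [exact: (submodP m) | exact: scaler0].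
have lF : linear (F : T (d t) -> A^o).
  move=> a u v; apply: (endo_basis_eq bM) => s sr; rewrite hF //.
  rewrite -[RHS]/(endo_fun (a * F u) (g s) + endo_fun (F v) (g s)).
  by rewrite endoMv !hF //; case: eqP => // _; rewrite endo0 addr0.
have killed_g (a : A) : killed_by (d t) (a (g t) : emod M).
  have [_ /(_ _ tr)[_ gt] _] := bM.
  by rewrite /killed_by /= -[LHS]/(y ^+ d t *: a (g t)) -endoZ gt endo0.
have lG : linear (fun a : A^o => to_submod (killed_by_submod (d t)) (killed_g a)).
  by move=> a b c; apply: val_inj.
exists (linear_of lF), (linear_of lG) => m; apply: val_inj.
by rewrite /= -[LHS]/(endo_fun (F m) (g t)) hF // eqxx.
Qed.

Variables p j : nat.
Hypothesis gap : forall t, (t < r)%N -> (d t <= p)%N || (j <= d t)%N.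
Hypothesis p_order : p = 0%N \/ exists2 t, (t < r)%N & d t = p.
Hypothesis j_order : exists2 t, (t < r)%N & d t = j.

Lemma killed_prod_projective : projective (T j * T p)%type.
Proof.
apply: projective_prod.
  by have [t tr <-] := j_order; apply: killed_projective.
have [->|[t tr <-]] := p_order; last exact: killed_projective.
apply: projective0 => v; apply: val_inj.
by rewrite -[LHS]scale1r -(homothety1 M) -(expr0 y); apply: (submodP v).
Qed.

(** The maps are [u] to [(u, - y ^+ (j - i) *: u)] and [(u, w)] to [y ^+ (j - i) *: u + w].
    Surjectivity is where the gap enters: the part of an element in summands of order at most [p] is
    in T p, and in a summand of order [d t >= j] an element killed by [y ^+ i] is a multiple of
    [y ^+ (d t - i)], hence [y ^+ (j - i)] times one killed by [y ^+ j]. *)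
Lemma gap_short_exact i : (p < i < j)%N ->
  exists (f : {linear T (p + j - i) -> (T j * T p)%type})
         (q : {linear (T j * T p)%type -> T i}),
    short_exact f q /\
    forall w, val (q w) = (y ^+ (j - i))%:h *: val w.1 + val w.2.
Proof.
move=> /andP[pi ij]; have [h1 h2 h3] := bM.
have hf1 (u : T (p + j - i)) : killed_by j (val u).
  apply: homothety_pow_le (submodP u).
  by rewrite leq_subLR leq_add2r ltnW.
have hf2 (u : T (p + j - i)) : killed_by p (- ((y ^+ (j - i))%:h *: val u)).
  rewrite /killed_by /= scalerN scalerA -homothetyM -exprD.
  rewrite addnBA ?(ltnW ij) //; apply/eqP; rewrite oppr_eq0; apply/eqP.
  exact: (submodP u).
have lf : linear (fun u => (to_submod (killed_by_submod j) (hf1 u),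
                           to_submod (killed_by_submod p) (hf2 u))).
  move=> a u v; congr pair; apply: val_inj => //=.
  by rewrite scalerDr homothety_scaleC opprD scalerN.
have hq (w : T j * T p) : killed_by i ((y ^+ (j - i))%:h *: val w.1 + val w.2).
  rewrite /killed_by /= scalerDr scalerA -homothetyM -exprD subnKC ?(ltnW ij) //.
  by rewrite (submodP w.1) (homothety_pow_le (ltnW pi) (submodP w.2)) addr0.
have lq : linear (fun w => to_submod (killed_by_submod i) (hq w)).
  move=> a u v; apply: val_inj; rewrite /= scalerDr homothety_scaleC.
  by rewrite scalerDr addrACA.
exists (linear_of lf), (linear_of lq); split=> //; split.
- by move=> u v /(congr1 (fun w => val w.1)) e; apply: val_inj.
- move=> v; have [c ev] := h1 (val v).
  have yc t : (t < r)%N -> divides (y ^+ d t) (y ^+ i * c t).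
    apply: (h3 (fun t => y ^+ i * c t)).
    under eq_bigr => s _ do rewrite -scalerA.
    by rewrite -scaler_sumr -ev; exact: (submodP v).
  have /choice[b hb] t : exists b, (t < r)%N -> ~~ (d t <= p)%N ->
      c t = b * y ^+ (d t - i).
    case tr: (t < r)%N; last by exists 0.
    case: (leqP (d t) p) => dp; first by exists 0.
    have jd : (j <= d t)%N by have := gap tr; rewrite leqNgt dp.
    have id := leq_trans (ltnW ij) jd.
    have [_ dn] := andP (h2 t tr).1.
    have [||b eb] := @divides_pow_cancel _ y n hR i (d t - i) (c t).
    - by rewrite subnKC.
    - by rewrite subnKC //; apply: yc.
    by exists b.
  (* The vector [u] collects the summands of order at least [j], divided by [y ^+ (j - i)]; [w]
     collects those of order at most [p]. *)
  pose u : M := \sum_(t < r) if (d t <= p)%N then 0 else (b t * y ^+ (d t - j)) *: g t.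
  pose w : M := \sum_(t < r) if (d t <= p)%N then c t *: g t else 0.
  have ku : killed_by j (u : emod M).
    rewrite /killed_by /= -[LHS]/(y ^+ j *: u) scaler_sumr big1 // => t _.
    case: (leqP (d t) p) => dp; first exact: scaler0.
    have jd : (j <= d t)%N by have := gap (ltn_ord t); rewrite leqNgt dp.
    rewrite scalerA mulrCA -exprD subnKC // -scalerA.
    by have [_ ->] := h2 t (ltn_ord t); rewrite scaler0.
  have kw : killed_by p (w : emod M).
    rewrite /killed_by /= -[LHS]/(y ^+ p *: w) scaler_sumr big1 // => t _.
    case: (leqP (d t) p) => dp; last exact: scaler0.
    rewrite scalerA mulrC -scalerA -(subnK dp) exprD -scalerA.
    by have [_ ->] := h2 t (ltn_ord t); rewrite !scaler0.
  exists (to_submod (killed_by_submod j) ku, to_submod (killed_by_submod p) kw).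
  apply: val_inj; rewrite /= -[LHS]/(y ^+ (j - i) *: u + w) ev scaler_sumr -big_split.
  apply: eq_bigr => t _ /=; case: (leqP (d t) p) => dp.
    by rewrite scaler0 add0r.
  have jd : (j <= d t)%N by have := gap (ltn_ord t); rewrite leqNgt dp.
  have nd : ~~ (d t <= p)%N by rewrite -ltnNge.
  rewrite addr0 scalerA mulrCA -exprD (hb t (ltn_ord t) nd).
  by congr ((_ * y ^+ _) *: _); rewrite addnC addnBA ?(ltnW ij) // subnK.
- move=> [u w]; split=> [/(congr1 val) /= /eqP|[v <-]].
    rewrite addr_eq0 => /eqP e.
    have ku : killed_by (p + j - i) (val u).
      rewrite /killed_by /= -addnBA ?(ltnW ij) // exprD homothetyM -scalerA e.
      by rewrite scalerN (submodP w) oppr0.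
    exists (to_submod (killed_by_submod (p + j - i)) ku).
    by congr pair; apply: val_inj => //=; rewrite e opprK.
  by apply: val_inj; rewrite /= subrr.
Qed.

(** A section [s] commutes with [alpha t0], so for [k = y ^+ (l - i) *: g t0] the components of
    [s k] are multiples of [y ^+ (l - i) *: g t0] and [y ^+ (l - p) *: g t0]. Mapping back gives [k
    = (b * y ^+ (j - i) + c * y ^+ (i - p)) *: k]; both exponents are positive, so [y] would divide
    1. *)
Lemma killed_not_projective i : (p < i < j)%N -> ~ projective (T i).
Proof.
move=> hi pT; have [f [q [[_ qs _] qE]]] := gap_short_exact hi.
have /andP[pi ij] := hi.
have [s hs] := pT _ _ q (idfun : {linear T i -> T i}) qs.
have [alpha ha] := exists_alpha bM t0r dmax.
have jl : (j <= l)%N by have [t tr <-] := j_order; apply: dmax.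
have il := leq_trans (ltnW ij) jl; have pl := leq_trans (ltnW pi) il.
have ln := max_le_n bM t0r.
have kk : killed_by i (y ^+ (l - i) *: g t0 : emod M).
  rewrite /killed_by /= -[LHS]/(y ^+ i *: (y ^+ (l - i) *: g t0)).
  by rewrite scalerA -exprD subnKC //; have [_ /(_ _ t0r)[]] := bM.
pose k := to_submod (killed_by_submod i) kk.
have ek : alpha t0 *: k = k.
  by apply: val_inj; rewrite /= -[LHS]/(alpha t0 (y ^+ (l - i) *: g t0)) endoZ (e_top t0r ha).
have yk : (y ^+ i)%:h *: k = 0 by apply: val_inj; exact: kk.
have es : alpha t0 *: s k = s k by rewrite -linearZ /= ek.
have ys : (y ^+ i)%:h *: s k = 0 by rewrite -linearZ /= yk linear0.
have coef m (v : M) : (m <= l)%N -> alpha t0 v = v -> y ^+ m *: v = 0 ->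
    exists b, v = (b * y ^+ (l - m)) *: g t0.
  move=> ml ev yv; have [c ec] := e_image bM t0r ha v; rewrite ev in ec.
  have [||b eb] := @divides_pow_cancel _ y n hR m (l - m) c.
  - by rewrite subnKC.
  - by rewrite subnKC //; apply/(cyclic_basis_eq0 _ bM t0r); rewrite -scalerA -ec.
  by exists b; rewrite ec eb.
have [b eb] := coef i (val (s k).1) il
  (congr1 (fun w => val w.1) es) (congr1 (fun w => val w.1) ys).
have [c ec] := coef p (val (s k).2) pl
  (congr1 (fun w => val w.2) es) (submodP (s k).2).
have := congr1 val (hs k); rewrite qE /= => E.
have {E} : (y ^+ (l - i) * (1 - (b * y ^+ (j - i) + c * y ^+ (i - p)))) *: g t0 = 0.
  rewrite mulrBr mulr1 scalerBl mulrDr scalerDl.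
  have -> : y ^+ (l - i) *: g t0 = y ^+ (j - i) *: (val (s k).1 : M) + val (s k).2.
    exact/esym/E.
  have -> : y ^+ (l - i) * (b * y ^+ (j - i)) = y ^+ (j - i) * (b * y ^+ (l - i)).
    by rewrite mulrCA [RHS]mulrCA; congr (_ * _); apply: mulrC.
  have -> : y ^+ (l - i) * (c * y ^+ (i - p)) = c * y ^+ (l - p).
    by rewrite mulrCA -exprD addnBA ?(ltnW pi) // subnK.
  by rewrite eb ec scalerA subrr.
move=> /(cyclic_basis_eq0 _ bM t0r); rewrite -{1}(subnK il) => dv.
have {dv} : divides (y ^+ i) (1 - (b * y ^+ (j - i) + c * y ^+ (i - p))).
  by apply: (divides_pow_cancel hR) dv; rewrite subnK.
have ipos : (0 < i)%N by apply: leq_ltn_trans pi.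
move=> /(divides_powW (a := 1) ipos); rewrite expr1 => -[x ex].
apply: (not_divides1 hR); exists (x + (b * y ^+ (j - i).-1 + c * y ^+ (i - p).-1)).
rewrite mulrDl mulrDl -!mulrA -!exprSr !prednK ?subn_gt0 //.
by rewrite -ex subrK.
Qed.

(** Induction on the length: a syzygy replaces [i] by [p + j - i], which again lies strictly between
    [p] and [j]. Stable retracts are kept in the statement because syzygies are only controlled up
    to them. *)
Lemma gap_no_resolution k : forall (N : lmodType A) i, (p < i < j)%N ->
  stable_retract (T i) N -> ~ proj_resolution N k.
Proof.
elim: k => [|k IH] N i hi sr res.
  apply: (killed_not_projective hi); apply: stable_retract_proj sr _.
  exact: proj_resolution0_inv.
have [f [q [fq _]]] := gap_short_exact hi.
have [K rK srK] := proj_resolution_syzygy res sr killed_prod_projective fq.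
apply: IH srK rK; have /andP[pi ij] := hi; apply/andP; split.
  by rewrite ltn_subRL addnC ltn_add2l.
by rewrite ltn_subLR ?ltn_add2r // (leq_trans (ltnW ij)) // leq_addl.
Qed.

End Gap.

Lemma finite_gldim_orders (R : comPzRingType) (y : R) n (hR : chain_ring y n)
    (M : lmodType R) r (g : nat -> M) d t0 :
  cyclic_basis y n r g d -> (t0 < r)%N ->
  (forall t, (t < r)%N -> (d t <= d t0)%N) -> finite_gldim (endo M) ->
  forall i, (0 < i <= d t0)%N -> exists2 t, (t < r)%N & d t = i.
Proof.
move=> bM t0r dmax [k [res _]] i /andP[i0 il]; apply: contrapT => ni.
pose order q := `[< exists2 t, (t < r)%N & d t = q >].
have exj : exists q, order q && (i < q)%N.
  exists (d t0); apply/andP; split; first by apply/asboolP; exists t0.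
  by rewrite ltn_neqAle il andbT; apply/eqP => e; apply: ni; exists t0.
have exp : exists q, ((q == 0%N) || order q) && (q < i)%N by exists 0%N.
have pmax q : ((q == 0%N) || order q) && (q < i)%N -> (q <= i)%N.
  by move=> /andP[_ /ltnW].
case: (ex_minnP exj) => j /andP[/asboolP oj ij] jmin.
case: (ex_maxnP exp pmax) => p /andP[op pi] pmax'.
apply: (@gap_no_resolution R y n hR M r g d bM t0 t0r dmax p j _ _ oj k _ i _
  (stable_retract_refl _) (res _)); last by rewrite pi ij.
- move=> t tr; have od : order (d t) by apply/asboolP; exists t.
  case: (ltngtP (d t) i) => [di|di|di].
  + by rewrite pmax' // od orbT.
  + by rewrite jmin ?orbT // od.
  + by case: ni; exists t.
- by case/orP: op => [/eqP|/asboolP]; [left | right].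
Qed.

(** * The theorem *)

Lemma gldim_unique (A : pzRingType) d e : gldim A d -> gldim A e -> d = e.
Proof.
move=> [rd [N [_ _ hN]]] [re [N' [_ _ hN']]].
by apply/eqP; rewrite eqn_leq hN // hN'.
Qed.

Section GlobalDimension.
Variables (R : comPzRingType) (y : R) (n : nat) (hR : chain_ring y n).
Variables (M : lmodType R) (r : nat) (g : nat -> M) (d : nat -> nat).
Hypothesis bM : cyclic_basis y n r g d.

Lemma gldim_orders1 :
  (forall i, (1 <= i <= 1)%N <-> exists2 t, (t < r)%N & d t = i) -> gldim (endo M) 0.
Proof.
move=> H; have [t0 t0r l1] := (H 1%N).1 isT.
have dmax t : (t < r)%N -> (d t <= d t0)%N.
  by move=> tr; rewrite l1; have /andP[] : (1 <= d t <= 1)%N by apply/H; exists t.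
have full i : (0 < i <= d t0)%N -> exists2 t, (t < r)%N & d t = i by rewrite l1 => /H.
have [alpha ha] := exists_alpha bM t0r dmax.
have res (N : lmodType (endo M)) : proj_resolution N 0.
  apply: proj_resolution0; apply: (alpha_exact_projective hR bM t0r dmax full ha).
  exact: (alpha_exact_simple bM t0r dmax ha N l1).
(* The value 0 is attained at the regular module, which is nonzero because the identity does not
   kill [g t0]. *)
split=> //; exists (endo M)^o; split=> // /(_ (1 : endo M)) e.
have [_ _ _] := hR; have : 1 *: g t0 = 0.
  by rewrite scale1r -[LHS]/((1 : endo M) (g t0)) [X in endo_fun X]e.
move=> /(cyclic_basis_eq0 _ bM t0r); rewrite l1 expr1 => dv _.
exact: (not_divides1 hR dv).
Qed.

Lemma gldim_orders2 l : (2 <= l)%N ->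
  (forall i, (1 <= i <= l)%N <-> exists2 t, (t < r)%N & d t = i) -> gldim (endo M) 2.
Proof.
move=> l2 H; have [|t0 t0r dl] := (H l).1; first by rewrite leqnn ltnW.
have dmax t : (t < r)%N -> (d t <= d t0)%N.
  by move=> tr; rewrite dl; have /andP[] : (1 <= d t <= l)%N by apply/H; exists t.
have full i : (0 < i <= d t0)%N -> exists2 t, (t < r)%N & d t = i by rewrite dl => /H.
have [alpha ha] := exists_alpha bM t0r dmax.
split=> [N|]; first exact: (proj_resolution2 hR bM t0r dmax full ha).
have [|N nN] := proj_resolution_pow2 hR bM t0r; first by rewrite dl.
exists N; split; [|exact: (proj_resolution2 hR bM t0r dmax full ha)|].
  by move=> /projective0/proj_resolution0/(proj_resolution_le (leq0n 1)).
move=> e res; rewrite ltnNge; apply/negP => e1; apply: nN.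
exact: proj_resolution_le e1 res.
Qed.

Lemma finite_gldim_full : finite_gldim (endo M) ->
  exists2 l, (0 < l <= n)%N &
    forall i, (1 <= i <= l)%N <-> exists2 t, (t < r)%N & d t = i.
Proof.
move=> fin; have [_ h2 _] := bM.
(* For [r = 0] the ring End(M) is zero and has no nonzero module attaining a dimension. *)
have r0 : (0 < r)%N.
  rewrite lt0n; apply/eqP => r0; have [k [_ [N [nz _ _]]]] := fin; apply: nz => v.
  rewrite -[v]scale1r; suff -> : (1 : endo M) = 0 by rewrite scale0r.
  by apply: (endo_basis_eq bM) => t; rewrite r0.
have [t0 t0r dmax] : exists2 t0, (t0 < r)%N & forall t, (t < r)%N -> (d t <= d t0)%N.
  have [i _ imax] := @arg_maxnP 'I_r (Ordinal r0) predT (fun i => d i) isT.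
  by exists i => // t tr; apply: (imax (Ordinal tr)).
exists (d t0); first by have [] := h2 _ t0r.
move=> i; split; first exact: (finite_gldim_orders hR bM t0r dmax fin).
by move=> [t tr <-]; rewrite dmax // andbT; have [/andP[]] := h2 _ tr.
Qed.

End GlobalDimension.

(** * Ideals, dimension and Cohen-Macaulay modules of a chain ring *)

Section ChainRingIdeals.
Variables (R : comPzRingType) (y : R) (n : nat) (hR : chain_ring y n).

Let m : set R := [set r | divides y r].

Lemma chain_ring_ideal : is_ideal m.
Proof.
split=> [|_ _ [b ->] [c ->]|c _ [b ->]]; first by exists 0; rewrite mul0r.
  by exists (b + c); rewrite mulrDl.
by exists (c * b); rewrite mulrA.
Qed.

Lemma proper_ideal_sub I : is_ideal I -> ~ I 1 -> I `<=` m.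
Proof.
move=> [_ _ IM] I1 r Ir; have [_ _ _ /(_ r)[//|[u e]]] := hR.
by case: I1; rewrite -e; apply: IM.
Qed.

Lemma chain_ring_local : is_local m.
Proof.
have mm : is_maximal_ideal m.
  split; [exact: chain_ring_ideal|exact: not_divides1 hR|].
  by move=> I iI I1 mI; apply/seteqP; split=> //; apply: proper_ideal_sub.
split=> // m' [im' m'1 max]; apply/esym/max; first exact: chain_ring_ideal.
  exact: not_divides1 hR.
exact: proper_ideal_sub.
Qed.

(** A prime ideal contains the nilpotent element [y], and every proper ideal is contained in [m]. *)
Lemma chain_ring_prime P : is_prime_ideal P -> P = m.
Proof.
move=> [iP P1 prP]; have [P0 _ PM] := iP; have [_ yn _ _] := hR.
apply/seteqP; split; first exact: proper_ideal_sub.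
move=> _ [b ->]; apply: PM; have : P (y ^+ n) by rewrite yn.
elim: n => [|k IH]; first by rewrite expr0.
by rewrite exprS => /prP[].
Qed.

Lemma chain_ring_krull_dim : krull_dim R 0.
Proof.
split=> [|[|e] p [pr lt] //].
  exists (fun=> m); split=> // i _; split; [exact: chain_ring_ideal|exact: not_divides1 hR|].
  move=> a b dab; have [_ _ _ Hr] := hR.
  have [|[u eu]] := Hr a; first by left.
  have [|[v ev]] := Hr b; first by right.
  case: (not_divides1 hR); rewrite -[1]mulr1 -{1}eu -ev mulrACA.
  exact: divides_mull.
have [_] := lt 0%N isT; rewrite (chain_ring_prime (pr 0%N isT)).
by rewrite (chain_ring_prime (pr 1%N isT)) => -[].
Qed.

(** The dimension is 0, and so is the depth: elements of [m] are nilpotent, so none is regular on a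
    nonzero module. *)
Lemma chain_ring_cohen_macaulay (M : lmodType R) : fin_gen M -> ~ zero_module M ->
  max_cohen_macaulay M.
Proof.
move=> fM nz; split=> //; exists m, 0%N; split.
- exact: chain_ring_local.
- exact: chain_ring_krull_dim.
have nil0 v : @seq_submod R M [::] v <-> v = 0.
  split=> [[w ->]|->]; first by rewrite big_ord0.
  by exists (fun _ => 0); rewrite big_ord0.
split.
  exists [::]; split=> //; split=> //.
  by apply: contrapT => h; apply: nz => v; apply: contrapT => v0; apply: h; exists v => /nil0.
case=> [//|a s] ms [reg [v nv]]; case: nv.
have a0 (w : M) : a *: w = 0 -> w = 0.
  by move=> aw; have := reg 0%N isT w; rewrite take0 => h; apply/nil0/h/nil0.
have [b eb] : divides y a by apply: ms; rewrite inE eqxx.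
have an : a ^+ n *: v = 0 by have [_ yn _ _] := hR; rewrite eb exprMn yn mulr0 scale0r.
have -> : v = 0.
  elim: n an => [|k IH]; first by rewrite expr0 scale1r.
  by rewrite exprS -scalerA => /a0/IH.
by exists (fun=> 0); rewrite big1 // => i _; rewrite scaler0.
Qed.

Lemma cyclic_basis_pquot i : (0 < i <= n)%N ->
  cyclic_basis y n 1 (fun=> \pi_(pquot (y ^+ i)) 1 : (pquot (y ^+ i) : lmodType R))
    (fun=> i).
Proof.
move=> i0; split=> [v|t _|c].
- by exists (fun=> repr v); rewrite big_ord1 -pquot_genE.
- by split=> //; rewrite pquot_scaleE; apply/pquot_eq0; exists 1; rewrite mulrC.
- by rewrite big_ord1 pquot_scaleE mulr1 => /pquot_eq0 dv [].
Qed.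

Definition pquot_pair_gen i j (t : nat) :
    ((pquot (y ^+ i) : lmodType R) * (pquot (y ^+ j) : lmodType R))%type :=
  if t == 0%N then (\pi_(pquot (y ^+ i)) 1, 0) else (0, \pi_(pquot (y ^+ j)) 1).

Lemma cyclic_basis_prod i j : (0 < i <= n)%N -> (0 < j <= n)%N ->
  cyclic_basis y n 2 (pquot_pair_gen i j) (fun t => if t == 0%N then i else j).
Proof.
move=> hi hj.
have E c : \sum_(t < 2) c (t : nat) *: pquot_pair_gen i j t
    = (\pi_(pquot (y ^+ i)) (c 0%N), \pi_(pquot (y ^+ j)) (c 1%N)).
  rewrite big_ord_recr big_ord1 /=; congr pair => /=.
    by rewrite scaler0 addr0 pquot_scaleE mulr1.
  by rewrite scaler0 add0r pquot_scaleE mulr1.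
split=> [[u v]|t _|c].
- exists (fun t => if t == 0%N then repr u else repr v).
  by rewrite (E (fun t => if t == 0%N then repr u else repr v)) /= !reprK.
- rewrite /pquot_pair_gen; case: eqP => _; split=> //; congr pair => /=;
    rewrite ?scaler0 // pquot_scaleE; apply/pquot_eq0.
    by exists 1; rewrite mulrC.
  by exists 1; rewrite mulrC.
- by rewrite E => -[/pquot_eq0 d0 /pquot_eq0 d1] [|[|]].
Qed.

Lemma cyclic_basis_neq0 (M : lmodType R) r (g : nat -> M) d :
  cyclic_basis y n r g d -> (0 < r)%N -> ~ zero_module M.
Proof.
move=> bM r0 /(_ (g 0%N)); rewrite -[g _]scale1r => /(cyclic_basis_eq0 _ bM r0) dv.
apply: (not_divides1 hR); rewrite -[y]expr1; apply: divides_powW dv.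
by have [_ /(_ _ r0)[/andP[]]] := bM.
Qed.

Lemma cyclic_basis_fin_gen (M : lmodType R) r (g : nat -> M) d :
  cyclic_basis y n r g d -> fin_gen M.
Proof.
move=> [h _ _]; exists r, (fun i => g i) => v.
by have [c ->] := h v; exists (fun i => c i).
Qed.

End ChainRingIdeals.

(** * From regular local rings of dimension one to chain rings *)

Lemma exists_maximal_ideal (S : comPzRingType) (I : set S) :
  is_ideal I -> ~ I 1 -> exists2 m, is_maximal_ideal m & I `<=` m.
Proof.
move=> iI I1.
(* Containing [I] is only required of nonempty [J], so that the union of an empty chain
   qualifies. *)
pose P (J : set S) := [/\ forall a b, J a -> J b -> J (a + b),
  forall c a, J a -> J (c * a), ~ J 1 & forall a, J a -> I `<=` J].
have [|J [[JD JM J1 JI] Jmax]] := @Zorn_bigcup S P.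
  move=> F FP tot; split.
  - move=> a b [J FJ Ja] [J' FJ' J'b].
    have [le|le] := tot _ _ FJ FJ'.
      by exists J' => //; have [D _ _ _] := FP _ FJ'; apply: D => //; apply: le.
    by exists J => //; have [D _ _ _] := FP _ FJ; apply: D => //; apply: le.
  - by move=> c a [J FJ Ja]; exists J => //; have [_ D _ _] := FP _ FJ; apply: D.
  - by move=> [J FJ Ja]; have [_ _ D _] := FP _ FJ; apply: D.
  - move=> a [J FJ Ja] b Ib; exists J => //; have [_ _ _ D] := FP _ FJ.
    exact: (D a).
have [I0 ID IM] := iI.
have IJ : I `<=` J.
  have [[a Ja]|none] := pselect (exists a, J a); first exact: JI Ja.
  case: (Jmax I); first by split=> [a Ja|IJ]; case: none; [exists a | exists 0; apply: IJ].
  by split=> // a _ b.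
exists J => //; split=> //; first by split=> //; apply: IJ.
move=> K [K0 KD KM] K1 JK; apply: contrapT => KJ; apply: (Jmax K).
  by split=> // KsJ; apply: KJ; apply/seteqP.
by split=> // a _ b /IJ/JK.
Qed.

(** In a chain of primes [p 0 < p 1], both inside (x), [x] is not in [p 0]. If
    [x ^+ n.-1 = b * x ^+ n], then [x ^+ n.-1 * (1 - b * x) = 0] puts [1 - b * x] in [p 0], so 1 in
    (x). An element outside (x) is invertible modulo [x] by maximality, hence modulo [x ^+ n]. *)
Lemma regular_local_chain_ring (S : comNzRingType) (x : S) n :
  regular_local_ring [set` principal x] 1 -> (0 < n)%N ->
  chain_ring (\pi_(pquot (x ^+ n)) x : pquot (x ^+ n)) n.
Proof.
move=> [_ [[im m1 mmax] mloc] [[p [ppr plt]] _] _] n0.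
set y : pquot _ := \pi_(pquot (x ^+ n)) x.
have yE k : y ^+ k = \pi_(pquot (x ^+ n)) (x ^+ k).
  elim: k => [|k IH]; first by rewrite !expr0.
  by rewrite !exprS IH pquot_mulE.
have yn : y ^+ n = 0 by rewrite yE; apply/pquot_eq0; exists 1; rewrite mul1r.
have sub i : (i <= 1)%N -> p i `<=` [set` principal x].
  move=> i1; have [ip p1 _] := ppr i i1.
  by have [m' mm' pm'] := exists_maximal_ideal ip p1; rewrite -(mloc _ mm').
split=> //.
- rewrite yE => /pquot_eq0[b eb]; have [p0i p01 p0pr] := ppr 0%N isT.
  have [p00 _ p0M] := p0i.
  have nx : ~ p 0%N x.
    move=> px; have [_] := plt 0%N isT; apply=> a /(sub 1%N isT)/asboolP[c ->].
    exact: p0M.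
  have : p 0%N (x ^+ n.-1 * (1 - b * x)).
    suff -> : x ^+ n.-1 * (1 - b * x) = 0 by [].
    rewrite mulrBr mulr1 mulrCA -exprSr prednK // -eb subrr //.
  case/p0pr.
    elim: n.-1 => [|k IH]; first by rewrite expr0.
    by rewrite exprS => /p0pr[].
  move=> /(sub 0%N isT)/asboolP[c ec]; apply: m1; apply/asboolP; exists (c + b).
  by rewrite mulrDl -ec subrK.
- elim/pquot_ind=> s.
  have [/asboolP[b ->]|ns] := pselect (s \in principal x).
    by left; exists (\pi b); rewrite pquot_mulE.
  right; pose I := [set a | exists b c, a = b * s + c * x].
  have [b [c e1]] : I 1.
    apply: contrapT => I1; apply: ns.
    have : I s by exists 1, 0; rewrite mul1r mul0r addr0.
    suff -> : I = [set` principal x] by [].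
    apply: mmax => //.
      split=> [|_ _ [b [c ->]] [b' [c' ->]]|a _ [b [c ->]]].
      - by exists 0, 0; rewrite !mul0r addr0.
      - by exists (b + b'), (c + c'); rewrite !mulrDl addrACA.
      - by exists (a * b), (a * c); rewrite mulrDr !mulrA.
    by move=> a /asboolP[c ->]; exists 0, c; rewrite mul0r add0r.
  have e : \pi_(pquot (x ^+ n)) b * \pi_(pquot (x ^+ n)) s
      = 1 - \pi_(pquot (x ^+ n)) c * y.
    apply/eqP; rewrite eq_sym subr_eq eq_sym; apply/eqP.
    by rewrite !pquot_mulE -pi_pquotD -e1.
  (* Geometric series inverting [1 - z] for the nilpotent [z], a multiple of [y]. *)
  exists ((\sum_(i < n) (\pi_(pquot (x ^+ n)) c * y) ^+ i) * \pi_(pquot (x ^+ n)) b).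
  rewrite -mulrA e mulrC; set z := _ * y.
  have : (1 - z) * \sum_(i < n) z ^+ i = 1 - z ^+ n.
    rewrite -[1 in RHS](expr1n _ n) subrXX; congr (_ * _); apply: eq_bigr => i _.
    by rewrite expr1n mul1r.
  by rewrite exprMn yn mulr0 subr0.
Qed.

(** For [n = 1] the ring is a field and only the value 0 occurs, whence the bound on [n] for the
    spectrum; likewise the value 2 is claimed only from [l = 2] on. *)
Theorem theorem4p9 (S : comNzRingType) (x : S) (n : nat)
  (hS : regular_local_ring [set` principal x] 1) (hn : (1 <= n)%N) :
  let R : comPzRingType := pquot (x ^+ n) in
  let xbar : R := \pi_(pquot (x ^+ n)) x in
  let Mi : nat -> lmodType R := fun i => pquot (xbar ^+ i) in
  (forall M : lmodType R, fin_gen M ->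
     [/\ finite_gldim (endo M) <->
           (add_eq M Mi 1 \/
            exists l : nat, (2 <= l <= n)%N /\ add_eq M Mi l),
         add_eq M Mi 1 -> gldim (endo M) 0
       & forall l : nat, (2 <= l <= n)%N -> add_eq M Mi l ->
           gldim (endo M) 2]) /\
  ((2 <= n)%N -> global_spectrum R = [set 0%N; 2%N]).
Proof.
move=> R xbar Mi; have hR : chain_ring xbar n := regular_local_chain_ring hS hn.
have n1 : (0 < 1 <= n)%N by [].
have main (M : lmodType R) : fin_gen M ->
    [/\ finite_gldim (endo M) <-> (add_eq M Mi 1 \/
            exists l : nat, (2 <= l <= n)%N /\ add_eq M Mi l),
         add_eq M Mi 1 -> gldim (endo M) 0
       & forall l : nat, (2 <= l <= n)%N -> add_eq M Mi l -> gldim (endo M) 2].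
  move=> /(exists_cyclic_basis hR)[r [g [d bM]]].
  have add1 : add_eq M Mi 1 -> gldim (endo M) 0.
    by move=> /(add_eq_orders hR bM n1)/(gldim_orders1 hR bM).
  have add2 l : (2 <= l <= n)%N -> add_eq M Mi l -> gldim (endo M) 2.
    move=> /andP[l2 ln] /(add_eq_orders hR bM)H.
    by apply: (gldim_orders2 hR bM l2); apply: H; rewrite ltnW.
  split=> //; split=> [|[/add1|[l [/add2 h /h]]]]; last 2 first.
  - by exists 0%N.
  - by exists 2%N.
  move=> /(finite_gldim_full hR bM)[l /[dup] hl /(add_eq_orders hR bM)[_ H] /H {}H].
  have [l1|l1] := eqVneq l 1%N; first by left; rewrite -l1.
  by right; exists l; split=> //; move: hl => /andP[l0 ->]; rewrite ltn_neqAle eq_sym l1 l0.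
split=> // n2; apply/seteqP; split=> [k [M [[fM _] gk]]|k].
  have [fin add1 add2] := main M fM.
  have [/add1 g0|[l [hl /(add2 l hl) g2]]] : add_eq M Mi 1 \/
      exists l : nat, (2 <= l <= n)%N /\ add_eq M Mi l by apply/fin; exists k.
    by left; apply: gldim_unique gk g0.
  by right; apply: gldim_unique gk g2.
have cm (M : lmodType R) r (g : nat -> M) d : cyclic_basis xbar n r g d -> (0 < r)%N ->
    max_cohen_macaulay M.
  move=> bM r0; apply: (chain_ring_cohen_macaulay hR).
    exact: cyclic_basis_fin_gen bM.
  exact: cyclic_basis_neq0 bM r0.
move=> [->|->].
  (* The residue field realises 0: its only order is 1. *)
  have b1 := cyclic_basis_pquot xbar n1.
  exists (pquot (xbar ^+ 1)); split; first exact: cm b1 _.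
  apply: (gldim_orders1 hR b1) => i; split=> [|[t _ <-]//].
  by rewrite -eqn_leq => /eqP <-; exists 0%N.
(* The sum of the cyclic modules of orders 1 and 2 realises 2; the order 2 is available since
   [n >= 2]. *)
have b2 := cyclic_basis_prod xbar n1 (n2 : (0 < 2 <= n)%N).
exists ((pquot (xbar ^+ 1) : lmodType R) * (pquot (xbar ^+ 2) : lmodType R))%type.
split; first exact: cm b2 _.
apply: (gldim_orders2 hR b2 (leqnn 2)) => i; split=> [|[t _ <-]]; last by case: eqP.
by case: i => [|[|[|]]] // _; [exists 0%N | exists 1%N].
Qed.
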